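(* Let $G$ be a finitely generated torsion-free nilpotent group, $H$ a subgroup of finite index $m>1$ in $G$, and $f:H\rightarrow G$ a homomorphism. If $f$ is simple then $s(G)\leq l(m)$. If $f$ is strongly simple then $c(G)\leq l(m)$.
   Context: $s(G)$ denotes the derived length of $G$ and $c(G)$ its nilpotency class. For an integer $m>1$, $l(m)$ is the number of prime divisors of $m$, counted with multiplicity. A subgroup $K$ of $G$ is $f$-invariant if $K\leq H$ and $K^f\leq K$, where $K^f$ is the image of $K$ under $f$. The homomorphism $f$ is simple if the only subgroup of $H$ that is both normal in $G$ and $f$-invariant is the trivial subgroup; it is strongly simple if the only $f$-invariant subgroup of $G$ is the trivial subgroup. *)

(* Defs.v *)
(* MathComp, with the classical sets of MathComp-Analysis: groups are possibly
   infinite [groupType]s, and subgroups of G are classical sets [set G]. *)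
From mathcomp Require Import all_boot.
From mathcomp Require Import boolp classical_sets functions cardinality.

Set Implicit Arguments.
Unset Strict Implicit.
Unset Printing Implicit Defensive.

Local Open Scope classical_set_scope.
Local Open Scope group_scope.

Section Subgroups.
Variable G : groupType.
Implicit Types (H K A B : set G) (f : G -> G).

Definition is_subgroup H : Prop :=
  [/\ H 1, (forall x y, H x -> H y -> H (x * y)) & (forall x, H x -> H x^-1)].

Definition is_normal_subgroup K : Prop :=
  is_subgroup K /\ (forall x g, K x -> K (x ^ g)).

Definition generated A : set G := smallest is_subgroup A.

Definition rcoset_of H (x : G) : set G := [set h * x | h in H].

Definition has_index H (m : nat) : Prop := (range (rcoset_of H) #= `I_m)%card.

Definition commutator_subgroup A B : set G :=
  generated [set z | exists x y, [/\ A x, B y & z = [~ x, y]]].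

(* A homomorphism H -> G is represented by a function on the whole of G whose
   values outside H are irrelevant. *)
Definition is_hom_on H f : Prop :=
  forall x y, H x -> H y -> f (x * y) = f x * f y.

Definition f_invariant H f K : Prop :=
  [/\ is_subgroup K, K `<=` H & f @` K `<=` K].

Definition simple_hom H f : Prop :=
  forall K, is_normal_subgroup K -> f_invariant H f K -> K = [set 1].

Definition strongly_simple_hom H f : Prop :=
  forall K, f_invariant H f K -> K = [set 1].

End Subgroups.

Definition finitely_generated (G : groupType) : Prop :=
  exists s : seq G, generated [set` s] = [set: G].

Definition torsion_free (G : groupType) : Prop :=
  forall (x : G) (n : nat), (0 < n)%N -> x ^+ n = 1 -> x = 1.

(* Indexing starts at 0 with the whole group. *)
Fixpoint lower_central (G : groupType) (n : nat) : set G :=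
  if n is k.+1 then commutator_subgroup (@lower_central G k) [set: G]
  else [set: G].

Fixpoint derived_series (G : groupType) (n : nat) : set G :=
  if n is k.+1
  then commutator_subgroup (@derived_series G k) (@derived_series G k)
  else [set: G].

Arguments lower_central G n : clear implicits.
Arguments derived_series G n : clear implicits.

Definition nilpotent_group (G : groupType) : Prop :=
  exists n, lower_central G n = [set 1].

(* The least element of P, and 0 when P is empty. *)
Definition least (P : set nat) : nat :=
  xget 0%N [set n | P n /\ (forall k, P k -> (n <= k)%N)].

Lemma leastP (P : set nat) (n : nat) : P n -> P (least P) /\ (least P <= n)%N.
Proof.
move=> Pn; have exP : exists k, `[< P k >] by exists n; apply/asboolP.
have [k /asboolP Pk kmin] := ex_minnP exP.
have [Pl lmin] : [set n | P n /\ (forall k, P k -> (n <= k)%N)] (least P).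
  by apply: (@xgetPex _ 0%N); exists k; split=> // j /asboolP; exact: kmin.
by split=> //; exact: lmin.
Qed.

(* Both sets below are nonempty for nilpotent G (a nilpotent group is soluble),
   so the default value of [least] plays no role there. *)
Definition nilpotency_class (G : groupType) : nat :=
  least [set n | lower_central G n = [set 1]].

Definition derived_length (G : groupType) : nat :=
  least [set n | derived_series G n = [set 1]].

(* Number of prime divisors of m > 0, counted with multiplicity. *)
Definition num_prime_divisors (m : nat) : nat :=
  (\sum_(p <- primes m) logn p m)%N.

(* Main.v *)
(* Write T_0 = G and let T_(j+1) be the isolator of [T_j, G].  This is a central
   series of G whose terms f respects, in the sense that f maps the intersection
   of H and T_j into T_j; torsion-freeness makes it reach 1.  The indices
   m_j = [H T_j : H] divide one another and go from m_0 = m down to 1, so at most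
   l(m) of the divisions are strict.

   Let K be a subgroup with T_j <= K <= H T_j that is invariant for the partial
   endomorphism of G / T_j induced by f.  If T_j <= H T_(j+1), then K has the same
   property for j + 1.  In general [K, K] T_(j+1) has it: modulo the central
   factor T_j / T_(j+1), every commutator of elements of K is a commutator of
   elements of K lying in H.  Starting from K = G one derivation is thus needed
   only at strict steps, and the final K is normal and f-invariant, hence trivial
   when f is simple.

   If f is strongly simple, then T_j <= H T_(j+1) forces T_j = T_(j+1).  Indeed,
   nontrivial invariant subgroups B / T_j of G / T_j propagate to j + 1: take
   [B, B] T_(j+1) if [B, B] is not inside T_(j+1).  Otherwise B / T_(j+1) is
   abelian, f acts integrally on its quotient B / T_j, so some monic integer
   polynomial g has g(f) mapping B into T_j; for rank reasons g(f) is not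
   injective, and an element of its kernel spans a finitely generated invariant
   subgroup.  So the number of nontrivial T_j is at most l(m). *)
From HB Require Import structures.
Require Import Defs.
From mathcomp Require Import all_boot all_algebra.
From mathcomp Require Import boolp classical_sets functions cardinality.

Set Implicit Arguments.
Unset Strict Implicit.
Unset Printing Implicit Defensive.

Import GRing.Theory.

Local Open Scope classical_set_scope.
Local Open Scope group_scope.

(** * Subgroups and quotients *)

Section SubgroupTheory.
Variable G : groupType.
Implicit Types (A B H K N : set G) (x y g : G).

Lemma subgroupX H x n : is_subgroup H -> H x -> H (x ^+ n).
Proof.
by move=> [H1 HM _] Hx; elim: n => // n IHn; rewrite expgS; exact: HM.
Qed.

Lemma subgroupMl H x y : is_subgroup H -> H x -> H (x * y) -> H y.
Proof.
by move=> [_ HM HV] /HV Hx Hxy; rewrite -(mulKg x y); exact: HM.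
Qed.

Lemma subgroupMr H x y : is_subgroup H -> H y -> H (x * y) -> H x.
Proof.
by move=> [_ HM HV] /HV Hy Hxy; rewrite -(mulgK y x); exact: HM.
Qed.

Lemma subgroupR H x y : is_subgroup H -> H x -> H y -> H [~ x, y].
Proof.
move=> [_ HM HV] Hx Hy.
by apply: (HM); [exact: HV|apply: (HM); [exact: HV|exact: HM]].
Qed.

Lemma generated_subgroup A : is_subgroup (generated A).
Proof.
split.
- by move=> H [[H1 _ _] _].
- move=> x y Ax Ay H HA; have [[_ HM _] _] := HA.
  by apply: HM; [exact: Ax|exact: Ay].
- by move=> x Ax H HA; have [[_ _ HV] _] := HA; apply: HV; exact: Ax.
Qed.

Lemma sub_generated A : A `<=` generated A.
Proof. exact: sub_smallest. Qed.

Lemma generated_sub A H : is_subgroup H -> A `<=` H -> generated A `<=` H.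
Proof. exact: smallest_sub. Qed.

Lemma generatedS A B : A `<=` B -> generated A `<=` generated B.
Proof.
move=> sAB; apply: generated_sub; first exact: generated_subgroup.
exact: subset_trans sAB (@sub_generated B).
Qed.

Lemma setT_subgroup : is_subgroup [set: G].
Proof. by []. Qed.

Lemma setI_subgroup H K : is_subgroup H -> is_subgroup K ->
  is_subgroup (H `&` K).
Proof.
move=> [H1 HM HV] [K1 KM KV]; split=> // [x y [Hx Kx] [Hy Ky]|x [Hx Kx]].
- by split; [exact: HM|exact: KM].
- by split; [exact: HV|exact: KV].
Qed.

Lemma generated_normal A :
  (forall x g, A x -> A (x ^ g)) -> is_normal_subgroup (generated A).
Proof.
move=> AJ; split=> [|x g]; first exact: generated_subgroup.
suff: generated A `<=` [set x | generated A (x ^ g)] by apply.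
have [A1 AM AV] := generated_subgroup A.
apply: generated_sub => [|y Ay /=]; last by apply: sub_generated; exact: AJ.
split=> /= [|y z Ay Az|y Ay]; rewrite ?conj1g ?conjMg ?conjVg //.
- exact: AM.
- exact: AV.
Qed.

Lemma normal_conj N x g : is_normal_subgroup N -> N (x ^ g) -> N x.
Proof. by case=> _ NJ /(NJ _ g^-1); rewrite conjgK. Qed.

Lemma normalC N x y : is_normal_subgroup N -> N (x * y) -> N (y * x).
Proof.
by move=> nN Nxy; apply: (@normal_conj _ _ y nN); rewrite conjgE -mulgA mulKg.
Qed.

Lemma commutator_subgroup_subgroup A B : is_subgroup (commutator_subgroup A B).
Proof. exact: generated_subgroup. Qed.

Lemma mem_commutator A B x y :
  A x -> B y -> commutator_subgroup A B [~ x, y].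
Proof. by move=> Ax By; apply: sub_generated; exists x, y. Qed.

Lemma commutator_sub A B H : is_subgroup H ->
  (forall x y, A x -> B y -> H [~ x, y]) -> commutator_subgroup A B `<=` H.
Proof.
by move=> sH HAB; apply: generated_sub => // _ [x [y [Ax By ->]]]; exact: HAB.
Qed.

Lemma commutatorS A A' B B' : A `<=` A' -> B `<=` B' ->
  commutator_subgroup A B `<=` commutator_subgroup A' B'.
Proof.
move=> sA sB; apply: commutator_sub => [|x y Ax By].
  exact: commutator_subgroup_subgroup.
by apply: mem_commutator; [exact: sA|exact: sB].
Qed.

Lemma commutator_normal A B : is_normal_subgroup A -> is_normal_subgroup B ->
  is_normal_subgroup (commutator_subgroup A B).
Proof.
move=> [_ AJ] [_ BJ]; apply: generated_normal => _ g [x [y [Ax By ->]]].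
by exists (x ^ g), (y ^ g); rewrite conjRg; split; [exact: AJ|exact: BJ|].
Qed.

Lemma commutator_normal_sub A B : is_normal_subgroup A ->
  commutator_subgroup A B `<=` A.
Proof.
move=> [sA AJ]; have [_ AM AV] := sA; apply: commutator_sub => // x y Ax _.
by apply: AM; [exact: AV|exact: AJ].
Qed.

Definition setM A B : set G := [set z | exists x y, [/\ A x, B y & z = x * y]].

Lemma setM_subgroup H N : is_subgroup H -> is_normal_subgroup N ->
  is_subgroup (setM H N).
Proof.
move=> [H1 HM HV] [[N1 NM NV] NJ]; split.
- by exists 1, 1; rewrite mulg1.
- move=> _ _ [x [n [Hx Nn ->]]] [x' [n' [Hx' Nn' ->]]].
  exists (x * x'), (n ^ x' * n'); split; first exact: HM.
    by apply: NM => //; exact: NJ.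
  by rewrite conjgE !mulgA mulgK.
- move=> _ [x [n [Hx Nn ->]]]; exists x^-1, (n^-1 ^ x^-1); split.
  + exact: HV.
  + by apply: NJ; exact: NV.
  + by rewrite conjgE invgK invgM !mulgA mulVg mul1g.
Qed.

Lemma setM_normal H N : is_normal_subgroup H -> is_normal_subgroup N ->
  is_normal_subgroup (setM H N).
Proof.
move=> [sH HJ] nN; split=> [|_ g [x [n [Hx Nn ->]]]]; first exact: setM_subgroup.
by exists (x ^ g), (n ^ g); rewrite conjMg; split; [exact: HJ|apply nN.2|].
Qed.

Lemma setM_subl A N : is_subgroup N -> A `<=` setM A N.
Proof. by move=> [N1 _ _] x Ax; exists x, 1; rewrite mulg1. Qed.

Lemma setM_subr H B : is_subgroup H -> B `<=` setM H B.
Proof. by move=> [H1 _ _] x Bx; exists 1, x; rewrite mul1g. Qed.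

Lemma setM_sub A B H : is_subgroup H -> A `<=` H -> B `<=` H -> setM A B `<=` H.
Proof.
by move=> [_ HM _] sA sB _ [x [y [Ax By ->]]]; apply: HM; [exact: sA|exact: sB].
Qed.

Lemma setMS A A' B B' : A `<=` A' -> B `<=` B' -> setM A B `<=` setM A' B'.
Proof.
by move=> sA sB _ [x [y [Ax By ->]]]; exists x, y; split=> //; [exact: sA|exact: sB].
Qed.

End SubgroupTheory.

(** * Quotients by normal subgroups, realised on chosen coset representatives *)

Section Quotient.
Variables (G : groupType) (N : set G) (nN : is_normal_subgroup N).
Implicit Types x y : G.

(** Equal cosets are equal sets, so the choice made by [xget] depends only on the coset. Equality of
    classes then becomes plain equality of representatives. *)
Definition coset_repr x : G := xget 1 [set y | N (x^-1 * y)].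

Lemma coset_reprP x : N (x^-1 * coset_repr x).
Proof.
apply: (@xgetPex _ 1 [set y | N (x^-1 * y)]).
by exists x; rewrite /= mulVg; case: nN => -[].
Qed.

Lemma eq_coset_repr x y : N (x^-1 * y) -> coset_repr x = coset_repr y.
Proof.
move=> Nxy; have [[_ NM NV] _] := nN.
congr (xget _ _); apply/seteqP; split=> z /= Nz.
- by have := NM _ _ (NV _ Nxy) Nz; rewrite invgM invgK -mulgA mulVKg.
- by have := NM _ _ Nxy Nz; rewrite -mulgA mulVKg.
Qed.

Lemma coset_repr_id x : coset_repr (coset_repr x) = coset_repr x.
Proof. by rewrite -(eq_coset_repr (coset_reprP x)). Qed.

(* The proof [nN] is a parameter of the type so that instance inference finds
   it. *)
Definition quotient of is_normal_subgroup N :=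
  {x : G | coset_repr x == x}.

HB.instance Definition _ := Choice.on (quotient nN).

Definition quot_pi x : quotient nN :=
  exist _ (coset_repr x) (introT eqP (coset_repr_id x)).

Lemma quot_pi_eq x y : quot_pi x = quot_pi y <-> N (x^-1 * y).
Proof.
have [[_ NM NV] _] := nN; split=> [[e]|/eq_coset_repr e]; last exact: val_inj.
have := NM _ _ (coset_reprP x) (NV _ (coset_reprP y)).
by rewrite e invgM invgK mulgA mulgK.
Qed.

Lemma quot_pi_val (u : quotient nN) : quot_pi (val u) = u.
Proof. by apply: val_inj; exact/eqP/(valP u). Qed.

Definition quot_mul (u v : quotient nN) := quot_pi (val u * val v).
Definition quot_inv (u : quotient nN) := quot_pi (val u)^-1.

Lemma quot_piM_subproof x y : quot_pi (x * y) = quot_mul (quot_pi x) (quot_pi y).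
Proof.
have [[_ NM NV] NJ] := nN; apply/quot_pi_eq => /=.
have := NM _ _ (NJ _ y (coset_reprP x)) (coset_reprP y).
by rewrite conjgE invgM -!mulgA mulVKg.
Qed.

Lemma quot_piV_subproof x : quot_pi x^-1 = quot_inv (quot_pi x).
Proof.
have [[_ NM NV] NJ] := nN; apply/quot_pi_eq => /=.
rewrite invgK; apply: (normalC nN).
by rewrite -[_^-1 * x]invgK; apply: NV; rewrite invgM invgK; exact: coset_reprP.
Qed.

Lemma quot_mulA : associative quot_mul.
Proof.
move=> u v w; rewrite -(quot_pi_val u) -(quot_pi_val v) -(quot_pi_val w).
by rewrite -!quot_piM_subproof mulgA.
Qed.

Lemma quot_mul1 : left_id (quot_pi 1) quot_mul.
Proof. by move=> u; rewrite -(quot_pi_val u) -quot_piM_subproof mul1g. Qed.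

Lemma quot_mulr1 : right_id (quot_pi 1) quot_mul.
Proof. by move=> u; rewrite -(quot_pi_val u) -quot_piM_subproof mulg1. Qed.

Lemma quot_mulV : left_inverse (quot_pi 1) quot_inv quot_mul.
Proof.
move=> u; rewrite -(quot_pi_val u) -quot_piV_subproof -quot_piM_subproof.
by rewrite mulVg.
Qed.

Lemma quot_mulrV : right_inverse (quot_pi 1) quot_inv quot_mul.
Proof.
move=> u; rewrite -(quot_pi_val u) -quot_piV_subproof -quot_piM_subproof.
by rewrite mulgV.
Qed.

HB.instance Definition _ := isGroup.Build (quotient nN)
  quot_mulA quot_mul1 quot_mulr1 quot_mulV quot_mulrV.

HB.instance Definition _ :=
  isMultiplicative.Build G (quotient nN) quot_pi quot_piM_subproof.
HB.instance Definition _ :=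
  Multiplicative_isUMagmaMorphism.Build G (quotient nN) quot_pi (erefl _).

Lemma quot_piM x y : quot_pi (x * y) = quot_pi x * quot_pi y.
Proof. exact: gmulfM. Qed.

Lemma quot_piV x : quot_pi x^-1 = (quot_pi x)^-1.
Proof. exact: gmulfV. Qed.

Lemma quot_piX x n : quot_pi (x ^+ n) = quot_pi x ^+ n.
Proof. exact: gmulfXn. Qed.

Lemma quot_piR x y : quot_pi [~ x, y] = [~ quot_pi x, quot_pi y].
Proof. exact: gmulfR. Qed.

Lemma quot_pi1 x : quot_pi x = 1 <-> N x.
Proof.
have e1 : quot_pi 1 = 1 by exact: gmulf1.
rewrite -e1; split.
- by move/esym/quot_pi_eq; rewrite invg1 mul1g.
- by move=> Nx; apply/esym/quot_pi_eq; rewrite invg1 mul1g.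
Qed.

End Quotient.

(** * Powers and commutators in nilpotent groups *)

Section Commutators.
Variable G : groupType.
Implicit Types x y z : G.

Lemma commMg x y z : [~ x * y, z] = [~ x, z] ^ y * [~ y, z].
Proof. by rewrite !commgEl conjMg invgM !conjgE !mulgA !mulgK. Qed.

Lemma commgM x y z : [~ x, y * z] = [~ x, z] * [~ x, y] ^ z.
Proof. by rewrite !commgEl !conjMg !conjgE !invgM !mulgA !mulgK. Qed.

Lemma commMg_central x y z : commute [~ x, z] y ->
  [~ x * y, z] = [~ x, z] * [~ y, z].
Proof. by move=> c; rewrite commMg conjgE c mulKg. Qed.

Lemma commgM_central x y z : commute [~ x, y] z ->
  [~ x, y * z] = [~ x, z] * [~ x, y].
Proof. by move=> c; rewrite commgM conjgE c mulKg. Qed.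

Lemma commgX_central x y m n : commute [~ x, y] x -> commute [~ x, y] y ->
  [~ x ^+ m, y ^+ n] = [~ x, y] ^+ (m * n).
Proof.
move=> cx cy.
have cxm k : [~ x ^+ k, y] = [~ x, y] ^+ k.
  elim: k => [|k IHk]; first by rewrite comm1g.
  rewrite expgS commMg_central ?IHk ?expgS //; exact: commuteX.
have c : commute [~ x ^+ m, y] y by rewrite cxm; apply/commute_sym/commuteX/commute_sym.
rewrite expgnA -cxm; elim: n => [|n IHn]; first by rewrite commg1.
rewrite (expgSr y) commgM_central IHn ?expgS //.
by apply/commute_sym/commuteX/commute_sym.
Qed.

End Commutators.

Section Series.
Variable G : groupType.
Implicit Types (A B H K N : set G) (x y g u : G).

(** Left-normed commutators [A, B, ..., B]. Both arguments vary because [A, G, ..., G] will be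
    compared with [B, H, ..., H]. *)
Fixpoint iter_comm A B i : set G :=
  if i is k.+1 then commutator_subgroup (iter_comm A B k) B else A.

(** A priori only a set; [isolator_normal] makes it a subgroup for normal K in a nilpotent group.
    Requiring [isolator H g] for every g is a weak form of finite index. *)
Definition isolator K : set G := [set x | exists2 n, (0 < n)%N & K (x ^+ n)].

Lemma lower_centralE i : lower_central G i = iter_comm [set: G] [set: G] i.
Proof. by elim: i => //= i ->. Qed.

Lemma iter_comm_subgroup A B i : is_subgroup A -> is_subgroup (iter_comm A B i).
Proof. by case: i => //= i _; exact: commutator_subgroup_subgroup. Qed.

Lemma iter_comm_normal A i : is_normal_subgroup A ->
  is_normal_subgroup (iter_comm A [set: G] i).
Proof.
move=> nA; elim: i => //= i IHi; apply: commutator_normal => //.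
Qed.

Lemma iter_commS A A' B i : A `<=` A' -> iter_comm A B i `<=` iter_comm A' B i.
Proof. by move=> sA; elim: i => //= i IHi; exact: commutatorS. Qed.

Lemma iter_comm_leq A B i j : is_subgroup A -> commutator_subgroup A B `<=` A ->
  (i <= j)%N -> iter_comm A B j `<=` iter_comm A B i.
Proof.
move=> sA sAB; move/subnK<-; elim: (_ - _)%N => // k IHk.
rewrite addSn; apply: subset_trans IHk; move: (k + i)%N => n.
elim: n => //= n IHn; exact: commutatorS.
Qed.

End Series.

Section PowersModulo.
Variables (G : groupType) (A B N : set G).
Hypotheses (sA : is_subgroup A) (sB : is_subgroup B) (nN : is_normal_subgroup N).
Hypothesis AGN : commutator_subgroup A [set: G] `<=` N.

Lemma commute_mod x g : A x -> commute (quot_pi nN x) (quot_pi nN g).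
Proof.
move=> Ax; apply/commgP/eqP; rewrite -quot_piR; apply/quot_pi1/AGN.
exact: mem_commutator.
Qed.

(** Elements of A are central modulo N, so taking powers is multiplicative on A modulo N. Hence the
    existence of a power in B modulo N need only be checked on generators of A. *)
Lemma powers_mod_subgroup :
  is_subgroup [set x | A x /\
    exists n b, [/\ (0 < n)%N, B b & N (b^-1 * x ^+ n)]].
Proof.
have [A1 AM AV] := sA; have [B1 BM BV] := sB.
split.
- split=> //; exists 1%N, 1; split=> //.
  by rewrite expg1 invg1 mul1g; case: nN => -[].
- move=> x y [Ax [n [b [n0 Bb /(quot_pi_eq nN) eb]]]].
  move=> [Ay [n' [b' [n'0 Bb' /(quot_pi_eq nN) eb']]]].
  split; first exact: AM.
  exists (n * n')%N, (b ^+ n' * b' ^+ n); split.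
  + by rewrite muln_gt0 n0.
  + by apply: BM; exact: subgroupX.
  + apply/(quot_pi_eq nN); rewrite quot_piM !quot_piX quot_piM expgMn.
      by rewrite eb eb' !quot_piX -!expgnA (mulnC n').
    exact: commute_mod.
- move=> x [Ax [n [b [n0 Bb /(quot_pi_eq nN) eb]]]]; split; first exact: AV.
  exists n, b^-1; split=> //; first exact: BV.
  by apply/(quot_pi_eq nN); rewrite quot_piX !quot_piV expVgn -quot_piX -eb.
Qed.

End PowersModulo.

Section PowerLemma.
Variables (G : groupType) (A B H : set G).
Hypotheses (nA : is_normal_subgroup A) (sB : is_subgroup B).
Hypothesis sBHB : commutator_subgroup B H `<=` B.
Hypothesis GH : forall g, isolator H g.

Local Notation A_ := (iter_comm A [set: G]).
Local Notation B_ := (iter_comm B H).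

Hypothesis AB : forall u, A u ->
  exists n b, [/\ (0 < n)%N, B b & A_ 1 (b^-1 * u ^+ n)].

(* Modulo the term A_(i+2), [u, g]^(n k) = [u^n, g^k], so powers of commutators
   can be taken in [B_i, H]. *)
Lemma power_step i u : A_ i u ->
  exists n b, [/\ (0 < n)%N, B_ i b & A_ i.+1 (b^-1 * u ^+ n)].
Proof.
elim: i u => [|i IHi] u; first exact: AB.
have nN := iter_comm_normal i.+2 nA.
set pi := quot_pi nN.
have cpi x g : A_ i.+1 x -> commute (pi x) (pi g) by exact: commute_mod.
have sA1 : is_subgroup (A_ i.+1) by apply: (iter_comm_normal _ nA).1.
have sB1 : is_subgroup (B_ i.+1) by exact: iter_comm_subgroup.
have sD := powers_mod_subgroup sA1 sB1 nN (@subset_refl _ _).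
set D := (X in is_subgroup X) in sD.
suff AD : A_ i.+1 `<=` D by move=> /AD [].
apply: commutator_sub => // {}u g Au _.
have [n [b [n0 Bb Ac]]] := IHi _ Au.
have [k k0 Hh] := GH g.
have Aug : A_ i.+1 [~ u, g] by exact: mem_commutator.
split=> //; exists (n * k)%N, [~ b, g ^+ k]; split.
- by rewrite muln_gt0 n0.
- exact: mem_commutator.
- apply/(quot_pi_eq nN); rewrite quot_piX -/pi.
  have c y : commute [~ pi u, pi g] (pi y) by rewrite /pi -quot_piR; exact: cpi.
  (* Write u^n = b d with d in A_(i+1). Since d is central modulo A_(i+2), it drops out of
     [b d, g^k]. *)
  have -> : pi [~ u, g] ^+ (n * k) = [~ pi b * pi (b^-1 * u ^+ n), pi (g ^+ k)].
    rewrite -quot_piM mulVKg /pi quot_piR -commgX_central ?quot_piX //; exact: c.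
  have cc : commute (pi (b^-1 * u ^+ n)) (pi (g ^+ k)) by exact: cpi.
  rewrite commMg; move/commgP/eqP: cc => ->; rewrite mulg1 /pi quot_piR conjgE.
  have -> : commute [~ pi b, pi (g ^+ k)] (pi (b^-1 * u ^+ n)).
    by apply/commute_sym; rewrite /pi -quot_piR; exact: cpi.
  by rewrite mulKg.
Qed.

(** Iterating [power_step] pushes the error deeper: if u^n = b d with d in A_(i+c), a power of d
    lies in B_(i+c), hence in B_i, modulo A_(i+c+1), and b commutes with d modulo that term. The
    error vanishes once A_c = 1. *)
Lemma power_isolator c i u : A_ c = [set 1] -> A_ i u -> isolator (B_ i) u.
Proof.
move=> Ac1 Au; have sBi j : is_subgroup (B_ j) by exact: iter_comm_subgroup.
suff [n [b [n0 Bb Ab]]] : exists n b,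
    [/\ (0 < n)%N, B_ i b & A_ (i + c) (b^-1 * u ^+ n)].
  have : A_ c (b^-1 * u ^+ n).
    apply: iter_comm_leq Ab; [exact: nA.1| |exact: leq_addl].
    exact: commutator_normal_sub.
  by rewrite Ac1 => /mulg1_eq; rewrite invgK => e; exists n; rewrite -?e.
elim: c {Ac1} => [|c [n [b [n0 Bb Ab]]]].
  by exists 1%N, 1; rewrite addn0 expg1 invg1 mul1g; split=> //; case: (sBi i).
have [n' [b' [n'0 Bb' Ab']]] := power_step Ab.
have [_ BM _] := sBi i.
exists (n * n')%N, (b ^+ n' * b'); split.
- by rewrite muln_gt0 n0.
- apply: BM; first exact: subgroupX.
  by apply: iter_comm_leq Bb' => //; exact: leq_addr.
- rewrite addnS; have nN := iter_comm_normal (i + c).+1 nA.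
  apply/(quot_pi_eq nN); rewrite expgnA -[u ^+ n](mulVKg b).
  set d := _ * u ^+ n in Ab Ab' *.
  rewrite quot_piM !quot_piX quot_piM expgMn -?quot_piX; last first.
    apply/commute_sym/commgP/eqP; rewrite -quot_piR; apply/quot_pi1.
    exact: mem_commutator.
  by congr (_ * _); exact/quot_pi_eq.
Qed.

End PowerLemma.

(** * The isolated central series *)

Lemma subset_isolator (G : groupType) (K : set G) : K `<=` isolator K.
Proof. by move=> x Kx; exists 1%N; rewrite ?expg1. Qed.

Lemma isolatorS (G : groupType) (K L : set G) :
  K `<=` L -> isolator K `<=` isolator L.
Proof. by move=> sKL x [n n0 /sKL Kx]; exists n. Qed.

Lemma isolator_id (G : groupType) (K : set G) :
  isolator (isolator K) `<=` isolator K.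
Proof.
move=> x [n n0 [k k0 Kx]]; exists (n * k)%N; rewrite ?expgnA //.
by rewrite muln_gt0 n0.
Qed.

Section IsolatedSeries.
Variables (G : groupType) (c : nat).
Hypothesis G_nil : lower_central G c = [set 1].
Implicit Types (A B H K : set G).

Lemma iter_comm_nilpotent A : is_subgroup A ->
  iter_comm A [set: G] c = [set 1].
Proof.
move=> sA; apply/seteqP; split.
  by rewrite -G_nil lower_centralE; exact: iter_commS.
by move=> _ ->; case: (iter_comm_subgroup [set: G] c sA).
Qed.

Lemma isolatorT (g : G) : isolator [set: G] g.
Proof. by exists 1%N. Qed.

(** Let A be the subgroup generated by the isolator. Its generators have powers in K, so all its
    elements do modulo [A, G], and [power_isolator] with i = 0 removes the error term. *)
Lemma isolator_normal K : is_normal_subgroup K ->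
  is_normal_subgroup (isolator K).
Proof.
move=> nK; have [sK KJ] := nK.
have IJ x g : isolator K x -> isolator K (x ^ g).
  by move=> [n n0 Kx]; exists n => //; rewrite -conjXg; exact: KJ.
split=> //; pose A := generated (isolator K).
have nA : is_normal_subgroup A by exact: generated_normal.
have sKA : K `<=` A.
  exact: subset_trans (@subset_isolator _ K) (@sub_generated _ _).
suff -> : isolator K = A by exact: generated_subgroup.
apply/seteqP; split; first exact: sub_generated.
move=> x; apply: (@power_isolator _ _ K [set: G] nA _ _ _ _ c 0) => //.
- exact: commutator_normal_sub.
- exact: isolatorT.
- have nA1 := iter_comm_normal 1 nA.
  have sD := powers_mod_subgroup nA.1 sK nA1 (@subset_refl _ _).
  set D := (X in is_subgroup X) in sD.
  suff AD : A `<=` D by move=> u /AD [].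
  apply: generated_sub => // y Iy; split; first exact: sub_generated.
  case: Iy => n n0 Ky; exists n, (y ^+ n); rewrite mulVg; split=> //.
  by case: nA1 => -[].
- by apply: iter_comm_nilpotent; case: nA.
Qed.

Fixpoint isolated_series j : set G :=
  if j is k.+1 then isolator (commutator_subgroup (isolated_series k) [set: G])
  else [set: G].

Local Notation T := isolated_series.

Lemma isolated_series_normal j : is_normal_subgroup (T j).
Proof.
by elim: j => //= j IHj; apply: isolator_normal; exact: commutator_normal.
Qed.

Lemma isolated_seriesK j : isolator (T j) `<=` T j.
Proof. by case: j => //= j; exact: isolator_id. Qed.

Lemma isolated_series_comm j : commutator_subgroup (T j) [set: G] `<=` T j.+1.
Proof. by move=> x; exact: subset_isolator. Qed.

Lemma isolated_series_sub j : T j.+1 `<=` T j.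
Proof.
apply: subset_trans (@isolated_seriesK j) => /=; apply: isolatorS.
by apply: commutator_normal_sub; exact: isolated_series_normal.
Qed.

Lemma lower_central_sub_isolated j : lower_central G j `<=` T j.
Proof.
elim: j => //= j IHj; apply: subset_trans (@subset_isolator _ _).
exact: commutatorS.
Qed.

(** Isolating at every stage adds no more than isolating the lower central term once:
    [power_isolator] with i = 1 puts [isolator of K, G] inside the isolator of [K, G]. *)
Lemma isolated_sub_isolator j : T j `<=` isolator (lower_central G j).
Proof.
elim: j => [|j IHj] /=; first by move=> x _; exact: isolatorT.
apply: subset_trans (@isolator_id _ _); apply: isolatorS.
apply: subset_trans (commutatorS IHj (@subset_refl _ _)) _.
have nK : is_normal_subgroup (lower_central G j).
  by rewrite lower_centralE; exact: iter_comm_normal.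
move=> x; have nI := isolator_normal nK.
apply: (@power_isolator _ _ (lower_central G j) [set: G] nI _ _ _ _ c 1).
- by case: nK.
- exact: commutator_normal_sub.
- exact: isolatorT.
- move=> u [n n0 Ku]; exists n, (u ^+ n); rewrite mulVg; split=> //.
  by case: (iter_comm_normal 1 nI) => -[].
- by apply: iter_comm_nilpotent; case: nI.
Qed.

Lemma isolated_series_eq1 : torsion_free G -> T c = [set 1].
Proof.
move=> G_tf; apply/seteqP; split; last first.
  by move=> _ ->; case: (isolated_series_normal c) => -[].
move=> x /isolated_sub_isolator [n n0]; rewrite G_nil; exact: G_tf.
Qed.

Variables (H : set G) (f : G -> G).
Hypotheses (sH : is_subgroup H) (GH : forall g, isolator H g).
Hypothesis f_hom : is_hom_on H f.

Lemma hom_on1 : f 1 = 1.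
Proof.
have [H1 _ _] := sH; apply: (@mulgI _ (f 1)).
by rewrite -f_hom // !mulg1.
Qed.

Lemma hom_onV x : H x -> f x^-1 = (f x)^-1.
Proof.
have [_ _ HV] := sH; move=> Hx; apply/esym/mulg1_eq.
by rewrite -f_hom ?mulgV ?hom_on1 //; exact: HV.
Qed.

Lemma hom_onX x n : H x -> f (x ^+ n) = f x ^+ n.
Proof.
move=> Hx; elim: n => [|n IHn]; first by rewrite hom_on1.
by rewrite !expgS f_hom ?IHn //; exact: subgroupX.
Qed.

Lemma hom_onR x y : H x -> H y -> f [~ x, y] = [~ f x, f y].
Proof.
have [_ HM HV] := sH; move=> Hx Hy.
have [Hx' Hy' Hxy] : [/\ H x^-1, H y^-1 & H (x * y)].
  by split; [exact: HV|exact: HV|exact: HM].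
rewrite /commg !conjgE !f_hom ?hom_onV //; exact: HM.
Qed.

(** Membership in H is carried through the induction, since f is multiplicative only on H. *)
Lemma hom_on_generated (A D : set G) : A `<=` H -> is_subgroup D ->
  (forall x, A x -> D (f x)) -> forall x, generated A x -> H x /\ D (f x).
Proof.
move=> sAH [D1 DM DV] fA; have [H1 HM HV] := sH.
suff : generated A `<=` [set x | H x /\ D (f x)] by [].
apply: generated_sub => [|x Ax]; last by split; [exact: sAH|exact: fA].
split=> /= [|x y [Hx Dx] [Hy Dy]|x [Hx Dx]].
- by rewrite hom_on1.
- by rewrite f_hom //; split; [exact: HM|exact: DM].
- by rewrite hom_onV //; split; [exact: HV|exact: DV].
Qed.

Lemma hom_on_commutator (A B A' B' : set G) : A `<=` H -> B `<=` H ->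
  (forall x, A x -> A' (f x)) -> (forall x, B x -> B' (f x)) ->
  forall x, commutator_subgroup A B x -> H x /\ commutator_subgroup A' B' (f x).
Proof.
move=> sAH sBH fA fB; apply: hom_on_generated.
- by move=> _ [x [y [/sAH Hx /sBH Hy ->]]]; exact: subgroupR.
- exact: commutator_subgroup_subgroup.
- move=> _ [x [y [Ax By ->]]]; rewrite hom_onR; [|exact: sAH|exact: sBH].
  by apply: mem_commutator; [exact: fA|exact: fB].
Qed.

(* Only commutators of elements of H are controlled by f, but up to powers they
   give all of [T_j, G]. *)
Lemma isolated_series_hom j x : T j x -> H x -> T j (f x).
Proof.
elim: j x => //= j IHj x [n n0 Tx] Hx.
have nT := isolated_series_normal j.
have : isolator (commutator_subgroup (T j `&` H) H) (x ^+ n).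
  apply: (@power_isolator _ _ (T j `&` H) H nT _ _ _ _ c 1) => //.
  - by apply: setI_subgroup => //; case: nT.
  - apply: commutator_sub; first by apply: setI_subgroup => //; case: nT.
    move=> y z [Ty Hy] Hz; split; last exact: subgroupR.
    by apply: (commutator_normal_sub nT); exact: (@mem_commutator _ _ [set: G]).
  - move=> u Tu; have [k k0 Hu] := GH u.
    exists k, (u ^+ k); rewrite mulVg; split=> //.
      by split=> //; apply: subgroupX => //; case: nT.
    by case: (iter_comm_normal 1 nT) => -[].
  - by apply: iter_comm_nilpotent; case: nT.
case=> k k0; rewrite -expgnA => /hom_on_commutator.
move=> /(_ (T j) [set: G]) []; rewrite ?hom_onX //.
- by move=> y [Ty Hy]; exact: IHj.
- by move=> _ Cx; exists (n * k)%N => //; rewrite muln_gt0 n0.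
Qed.

End IsolatedSeries.
Arguments isolated_series G j : clear implicits.

(** * Indices *)

Section PrimeDivisors.
Local Open Scope nat_scope.

(** A range independent of n lets the sums for a, b and a b be compared term by term; the added
    terms have zero valuation. *)
Lemma num_prime_divisorsE n k : n < k ->
  num_prime_divisors n = \sum_(0 <= p < k) logn p n.
Proof.
move=> nk; rewrite /num_prime_divisors.
have perm : perm_eq (primes n) [seq p <- index_iota 0 k | p \in primes n].
  apply: uniq_perm; first exact: primes_uniq.
    by rewrite filter_uniq // iota_uniq.
  move=> p; rewrite mem_filter mem_index_iota /=.
  have [|//] := boolP (p \in primes n); rewrite mem_primes => /and3P[_ n0 pn].
  by rewrite (leq_ltn_trans (dvdn_leq n0 pn)).
rewrite (perm_big _ perm) big_filter big_mkcond; apply: eq_bigr => p _.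
by case: ifPn => //; rewrite -logn_gt0 lt0n negbK => /eqP ->.
Qed.

Lemma num_prime_divisorsM a b : 0 < a -> 0 < b ->
  num_prime_divisors (a * b) = num_prime_divisors a + num_prime_divisors b.
Proof.
move=> a0 b0; have ab0 : 0 < a * b by rewrite muln_gt0 a0.
rewrite !(@num_prime_divisorsE _ (a * b).+1) ?ltnS //.
- by rewrite -big_split /=; apply: eq_bigr => p _; rewrite lognM.
- by rewrite leq_pmull.
- by rewrite leq_pmulr.
Qed.

Lemma num_prime_divisors_gt0 n : 1 < n -> 0 < num_prime_divisors n.
Proof.
move=> n1; have pn : pdiv n \in primes n.
  by rewrite mem_primes pdiv_prime // pdiv_dvd (ltnW n1).
by rewrite /num_prime_divisors (big_rem _ pn) /= addn_gt0 logn_gt0 pn.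
Qed.

Lemma ltn_num_prime_divisors a b : 0 < b -> a %| b -> a != b ->
  num_prime_divisors a < num_prime_divisors b.
Proof.
move=> b0 /dvdnP [d bE]; move: b0; rewrite {}bE muln_gt0 => /andP[d0 a0] ne.
rewrite num_prime_divisorsM // -[X in X < _]add0n ltn_add2r.
apply: num_prime_divisors_gt0.
by case: d d0 ne => [|[|d]] //; rewrite mul1n eqxx.
Qed.

End PrimeDivisors.

(** * Coset labels and indices of subgroups containing [H] *)

Section Cosets.
Variables (G : groupType) (H : set G) (m : nat).
Hypotheses (sH : is_subgroup H) (H_index : has_index H m).

Lemma rcoset_of_eq x y : rcoset_of H x = rcoset_of H y <-> H (x / y).
Proof.
have [H1 HM HV] := sH; split.
  move=> e; have : rcoset_of H x x by exists 1; rewrite ?mul1g.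
  by rewrite e => -[h Hh <-]; rewrite mulgK.
move=> Hxy; apply/seteqP; split=> _ [h Hh <-].
  by exists (h * (x / y)); [exact: HM|rewrite mulgA mulgVK].
exists (h * (x / y)^-1); first by apply: HM => //; exact: HV.
by rewrite invgF mulgA mulgVK.
Qed.

(** The cardinality hypothesis becomes a labelling of right cosets by ['I_m], so that indices are
    counted with finite sets of labels. *)
Lemma coset_index_exists : exists c : G -> 'I_m,
  (forall i, exists x, c x = i) /\ (forall x y, c x = c y <-> H (x / y)).
Proof.
have [g] := pcard_eqP H_index.
have gm x : (g (rcoset_of H x) < m)%N.
  have : `I_m (g (rcoset_of H x)) by apply: funS; exists x.
  by [].
exists (fun x => Ordinal (gm x)); split=> [i|x y].
  have [|_ [x _ <-] e] := @surj _ _ _ _ g i; first exact: ltn_ord.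
  by exists x; exact: val_inj.
rewrite -rcoset_of_eq; split=> [[e]|e]; last by apply: val_inj; rewrite /= e.
by apply: (@inj _ _ _ g) e; rewrite inE; [exists x|exists y].
Qed.

End Cosets.

Section SubgroupIndex.
Variables (G : groupType) (H : set G) (m : nat) (c : G -> 'I_m).
Hypotheses (sH : is_subgroup H) (c_surj : forall i, exists x, c x = i).
Hypothesis cP : forall x y, c x = c y <-> H (x / y).
Implicit Types X Y : set G.

Lemma finite_index_power g : exists2 n, (0 < n <= m)%N & H (g ^+ n).
Proof.
(* Pigeonhole: the m + 1 powers g^0, ..., g^m have only m labels. *)
have /injectivePn [i [j ij e]] : ~~ injectiveb (fun i : 'I_m.+1 => c (g ^+ i)).
  by apply/injectiveP => /leq_card; rewrite !card_ord ltnn.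
wlog lij : i j ij e / (i < j)%N.
  have [lij|lji|/val_inj] := ltngtP i j.
  - by move=> wl; exact: (wl i j).
  - by move=> wl; apply: (wl j i) => //; rewrite eq_sym.
  - by move=> eij; rewrite eij eqxx in ij.
exists (j - i)%N.
  by rewrite subn_gt0 lij (leq_trans (leq_subr _ _)) // -ltnS.
by rewrite expgnFr ?(ltnW lij) //; apply/cP.
Qed.

(** One exponent serves all g, because the exponent found for each g is at most m and so divides m!.
    This uniformity is what makes [scaled_end] below total. *)
Lemma finite_index_fact g : H (g ^+ m`!).
Proof.
have [n /andP[n0 nm] Hg] := finite_index_power g.
have /dvdnP [k ->] : n %| m`! by apply: dvdn_fact; rewrite n0.
by rewrite mulnC expgnA; exact: subgroupX.
Qed.

Definition coset_image Y : {set 'I_m} := [set i | `[< exists2 y, Y y & c y = i >]]%SET.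

(* This is the index of H in Y when H is contained in Y. *)
Definition rel_index Y := #|coset_image Y|.

Lemma coset_imageP Y i : reflect (exists2 y, Y y & c y = i) (i \in coset_image Y).
Proof. by rewrite inE; exact: asboolP. Qed.

Lemma mem_coset_image Y y : is_subgroup Y -> H `<=` Y ->
  c y \in coset_image Y <-> Y y.
Proof.
move=> [_ YM YV] HY; split=> [/coset_imageP[z Yz /esym/cP/HY Hyz]|Yy].
  by rewrite -(mulgVK z y); exact: YM.
by apply/coset_imageP; exists y.
Qed.

Lemma rel_indexT : rel_index [set: G] = m.
Proof.
rewrite /rel_index -[RHS]card_ord -cardsT; congr #|pred_of_set _|.
apply/setP => i; rewrite finset.in_setT; apply/coset_imageP.
by have [x <-] := c_surj i; exists x.
Qed.

(** Lagrange's theorem [Y : H] = [Y : X] [X : H]: the labels met by Y are partitioned according to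
    right cosets of X, and all blocks have as many labels as X. *)
Lemma rel_indexS X Y : is_subgroup X -> is_subgroup Y -> H `<=` X -> X `<=` Y ->
  rel_index X %| rel_index Y.
Proof.
move=> sX sY HX XY; have [X1 XM XV] := sX; have [_ YM YV] := sY.
have HY := subset_trans HX XY.
have [rep repK] := choice c_surj.
have repX x : X x -> X (rep (c x)).
  by move=> Xx; apply/mem_coset_image; rewrite ?repK //; apply/mem_coset_image.
have repY x : Y x -> Y (rep (c x)).
  by move=> Yx; apply/mem_coset_image; rewrite ?repK //; apply/mem_coset_image.
pose R i j := `[< X (rep j / rep i) >].
have RE : {in coset_image Y & &, equivalence_rel R}.
  move=> i j k _ _ _; split; first by apply/asboolP; rewrite mulgV.
  move/asboolP => Xij; apply/asboolP/asboolP => Xk.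
  - have := XM _ _ Xk (XV _ Xij).
    by rewrite invgF mulgA mulgVK.
  - have := XM _ _ Xk Xij; by rewrite mulgA mulgVK.
have pP := equivalence_partitionP RE.
rewrite /rel_index (card_uniform_partition (n := rel_index X) _ pP) ?dvdn_mull //.
move=> _ /imsetP [i /coset_imageP [y Yy <-] ->]; rewrite /rel_index.
set i0 := c y; have Yi : Y (rep i0) by exact: repY.
(* Right translation by a representative of the block permutes right cosets of H, and carries the
   labels of X onto the block. *)
pose t (k : 'I_m) := c (rep k * rep i0).
rewrite -(@card_in_imset _ _ t (mem (coset_image X))); last first.
  move=> k k' _ _ /cP; rewrite invgM mulgA mulgK => /cP.
  by rewrite !repK.
congr #|pred_of_set _|; apply/setP => j; rewrite inE; apply/andP/imsetP.
- move=> [/coset_imageP [z Yz <-]] /asboolP Xj.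
  exists (c (rep (c z) / rep i0)); first exact/mem_coset_image.
  apply/cP.
  have : H (z / rep (c z)) by apply/cP; rewrite repK.
  have : H (rep (c z) / rep i0 / rep (c (rep (c z) / rep i0))).
    by apply/cP; rewrite repK.
  have [_ HM _] := sH; move=> h1 h2; have := HM _ _ h2 h1.
  by rewrite invgM !mulgA mulgVK.
- move=> [k /coset_imageP [x Xx <-] ->].
  have Xk : X (rep (c x)) by exact: repX.
  split; first by apply/mem_coset_image => //; apply: YM => //; exact: XY.
  apply/asboolP; set w := rep (c x) * rep i0.
  have Hw : H (rep (c w) / w) by apply/cP; rewrite repK.
  have := XM _ _ (HX _ Hw) Xk.
  by rewrite /w invgM !mulgA mulgVK.
Qed.

Lemma rel_index_eq X Y : is_subgroup X -> is_subgroup Y -> H `<=` X -> X `<=` Y ->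
  rel_index X = rel_index Y -> Y `<=` X.
Proof.
move=> sX sY HX XY e y Yy.
have sF : (coset_image X \subset coset_image Y)%SET.
  by apply/fintype.subsetP => i /coset_imageP [x /XY Yx <-]; apply/coset_imageP; exists x.
have eF : coset_image X = coset_image Y.
  by apply/eqP; rewrite eqEcard sF /=; move: e; rewrite /rel_index => ->.
apply/(mem_coset_image _ sX HX); rewrite eF.
by apply/(mem_coset_image _ sY) => //; exact: subset_trans XY.
Qed.

End SubgroupIndex.

(** * Subgroups of finitely generated nilpotent groups *)

Section Noetherian.
Variable G : groupType.
Implicit Types (D M N S : set G) (s : seq G).

(** The finite list lies in S but need not lie in M. In this form the property composes along chains
    of subgroups. *)
Definition noetherian_mod N M : Prop := forall S, is_subgroup S ->
  exists s, [set` s] `<=` S /\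
    forall x, S x -> M x -> exists2 y, generated [set` s] y & N (y^-1 * x).

Lemma noetherian_mod_refl N : is_subgroup N -> noetherian_mod N N.
Proof.
move=> _ S sS; exists [::]; split=> // x Sx Nx; exists 1.
  by case: (generated_subgroup [set` [::] : seq G]).
by rewrite invg1 mul1g.
Qed.

Lemma noetherian_mod_trans N M D :
  noetherian_mod N M -> noetherian_mod M D -> noetherian_mod N D.
Proof.
move=> NM MD S sS; have [_ SM SV] := sS.
have [s [sS1 sP]] := NM _ sS; have [t [tS tP]] := MD _ sS.
exists (t ++ s); split=> [x /=|x Sx Dx].
  by rewrite mem_cat => /orP [/tS|/sS1].
have [y ty Myx] := tP _ Sx Dx.
have Sy : S y by apply: generated_sub ty.
have [|z sz Nz] := sP (y^-1 * x) _ Myx; first by apply: SM => //; exact: SV.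
have [_ gM _] := generated_subgroup [set` t ++ s].
exists (y * z); last by rewrite invgM -mulgA.
apply: gM.
- by apply: generatedS ty => u /= ut; rewrite mem_cat ut.
- by apply: generatedS sz => u /= us; rewrite mem_cat us orbT.
Qed.

(** As for subgroups of the integers: an element of S congruent to a power of a with least positive
    exponent generates S modulo N within M, by division with remainder. Integer exponents are
    written as differences of naturals. *)
Lemma noetherian_mod_cyclic N M a (nN : is_normal_subgroup N) :
  (forall x, M x -> exists e e', quot_pi nN x = quot_pi nN (a ^+ e / a ^+ e')) ->
  noetherian_mod N M.
Proof.
move=> MP S sS; have [S1 SM SV] := sS.
(* Replacing x by its inverse if necessary makes the exponent a natural number. *)
have MP' x : S x -> M x -> exists e y, [/\ S y, y = x \/ y = x^-1 &
    quot_pi nN y = quot_pi nN (a ^+ e)].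
  move=> Sx /MP [e [e' xE]]; have [le|/ltnW le] := leqP e' e.
    by exists (e - e')%N, x; split; [|left|rewrite xE expgnFr].
  exists (e' - e)%N, x^-1; split; [exact: SV|by right|].
  by rewrite quot_piV xE -quot_piV invgF expgnFr.
pose P d := (0 < d)%N && `[< exists2 y, S y & quot_pi nN y = quot_pi nN (a ^+ d) >].
have [/ex_minnP [d /andP[d0 /asboolP [t St td]] d_min]|noP] := pselect (exists d, P d).
  exists [:: t]; split=> [x /=|x Sx Mx]; first by rewrite inE => /eqP ->.
  have [gt1 gtM gtV] := generated_subgroup [set` [:: t]].
  have gt : generated [set` [:: t]] t by apply: sub_generated; rewrite /= inE.
  have [e [y [Sy yx ye]]] := MP' _ Sx Mx.
  have tq : generated [set` [:: t]] (t ^+ (e %/ d)).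
    exact: subgroupX (generated_subgroup _) gt.
  have Ny : quot_pi nN (t ^+ (e %/ d)) = quot_pi nN y.
    have ty : quot_pi nN ((t ^+ (e %/ d))^-1 * y) = quot_pi nN (a ^+ (e %% d)).
      rewrite quot_piM ye quot_piV quot_piX td -quot_piX -quot_piV -quot_piM.
      by rewrite {2}(divn_eq e d) expgnDr mulnC expgnA mulKg.
    have [r0|r0] := posnP (e %% d).
      move: ty; rewrite r0 expg0 => /quot_pi_eq; rewrite mulg1 => h.
      by apply/quot_pi_eq; have [[_ _ NV] _] := nN; rewrite -[_ * _]invgK; exact: NV.
    have /d_min : P (e %% d).
      apply/andP; split=> //; apply/asboolP; exists ((t ^+ (e %/ d))^-1 * y) => //.
      by apply: SM => //; apply: SV; exact: subgroupX.
    by rewrite leqNgt ltn_mod d0.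
  case: yx => yx; [exists (t ^+ (e %/ d)) => //|exists (t ^+ (e %/ d))^-1].
  - by apply/(quot_pi_eq nN); rewrite -yx.
  - exact: gtV.
  - by apply/(quot_pi_eq nN); rewrite quot_piV Ny yx quot_piV invgK.
exists [::]; split=> // x Sx Mx; exists 1.
  by case: (generated_subgroup [set` [::] : seq G]).
have [e [y [Sy yx ye]]] := MP' _ Sx Mx.
have e0 : e = 0%N.
  apply/eqP; rewrite -leqn0 leqNgt; apply/negP => e0; apply: noP; exists e.
  by apply/andP; split=> //; apply/asboolP; exists y.
move: ye; rewrite e0 expg0 => ye.
have [[_ _ NV] _] := nN; rewrite invg1 mul1g.
by case: yx ye => -> /quot_pi_eq; rewrite mulg1 ?invgK // => /NV; rewrite invgK.
Qed.

Lemma normal_between N D : is_subgroup D -> N `<=` D ->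
  commutator_subgroup D [set: G] `<=` N -> is_normal_subgroup D.
Proof.
move=> sD ND DGN; split=> // x g Dx; have [_ DM _] := sD.
rewrite -(mulVKg x (x ^ g)) -commgEl; apply: DM => //.
by apply/ND/DGN; exact: mem_commutator.
Qed.

Lemma centralizer_mod_subgroup N (nN : is_normal_subgroup N) a :
  is_subgroup [set x | commute (quot_pi nN a) (quot_pi nN x)].
Proof.
split=> /= [|x y cx cy|x cx].
- have -> : quot_pi nN 1 = 1 by apply/quot_pi1; have [[]] := nN.
  exact: commute1.
- by rewrite quot_piM; exact: commuteM.
- by rewrite quot_piV; exact: commuteV.
Qed.

(** Generators central modulo N are adjoined one at a time; every intermediate subgroup is normal
    and every successive quotient cyclic. *)
Lemma noetherian_mod_central N s : is_normal_subgroup N ->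
  (forall x g, x \in s -> N [~ x, g]) ->
  noetherian_mod N (generated ([set` s] `|` N)).
Proof.
move=> nN; elim: s => [|a s IHs] sN.
  suff -> : generated ([set` [::]] `|` N) = N by apply: noetherian_mod_refl; case: nN.
  apply/seteqP; split; last by move=> x Nx; apply: sub_generated; right.
  by apply: generated_sub => [|x [//|//]]; case: nN.
set M := generated ([set` s] `|` N) in IHs.
have sM : is_subgroup M by exact: generated_subgroup.
have NM : N `<=` M by move=> x Nx; apply: sub_generated; right.
have nM : is_normal_subgroup M.
  rewrite /M; apply: (@normal_between N) => //; apply: commutator_sub => [|x g Mx _].
    by case: nN.
  suff : M `<=` [set y | commute (quot_pi nN g) (quot_pi nN y)].
    by move=> /(_ _ Mx) /commute_sym/commgP/eqP; rewrite -quot_piR => /quot_pi1.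
  apply: generated_sub => [|y [ys|/(quot_pi1 nN)]].
  - exact: centralizer_mod_subgroup.
  - apply/commute_sym/commgP/eqP; rewrite -quot_piR; apply/quot_pi1/sN.
    by rewrite inE ys orbT.
  - by move=> y1; rewrite /= y1; exact: commute1.
apply: (@noetherian_mod_trans _ M).
  by apply: IHs => x g xs; apply: sN; rewrite inE xs orbT.
apply: (@noetherian_mod_cyclic _ _ a nM).
suff : generated ([set` a :: s] `|` N) `<=`
    [set x | exists e e', quot_pi nM x = quot_pi nM (a ^+ e / a ^+ e')] by [].
apply: generated_sub => [|x [|Nx]].
- split=> /=.
  + by exists 0%N, 0%N; rewrite mulgV.
  + move=> x y [e [e' xE]] [k [k' yE]]; exists (e + k)%N, (k' + e')%N.
    rewrite quot_piM xE yE -quot_piM !expgnDr invgM !mulgA; congr (quot_pi nM (_ * _)).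
    rewrite -!mulgA; congr (_ * _).
    by apply/commute_sym/commuteV/commuteX2.
  + by move=> x [e [e' xE]]; exists e', e; rewrite quot_piV xE -quot_piV invgF.
- rewrite /= inE => /orP [/eqP ->|xs].
    by exists 1%N, 0%N; rewrite expg1 divg1.
  exists 0%N, 0%N; rewrite mulgV; apply/quot_pi_eq; rewrite mulg1.
  by case: sM => _ _; apply; apply: sub_generated; left.
- exists 0%N, 0%N; rewrite mulgV; apply/quot_pi_eq; rewrite mulg1.
  by case: sM => _ _; apply; exact: NM.
Qed.

Lemma lower_central_normal i : is_normal_subgroup (lower_central G i).
Proof. by rewrite lower_centralE; exact: iter_comm_normal. Qed.

(** Commutators of generators of one term, taken modulo the next, with generators of G generate the
    next term modulo the one after. Modulo the subgroup D that they generate with that last term,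
    generators commute, and centralizers are subgroups. *)
Lemma lower_central_fg i : finitely_generated G -> exists s,
  [set` s] `<=` lower_central G i /\
  lower_central G i `<=` generated ([set` s] `|` lower_central G i.+1).
Proof.
move=> [s0 s0G]; elim: i => [|i [s [s_sub s_gen]]].
  exists s0; split=> //; rewrite /= -s0G.
  by apply: generatedS => x; left.
pose s1 := [seq [~ a, b] | a <- s, b <- s0].
have s1_sub : [set` s1] `<=` lower_central G i.+1.
  by move=> _ /allpairsP [[a b] /= [/s_sub sa _ ->]]; exact: mem_commutator.
exists s1; split=> //; set D := generated _.
have nC := lower_central_normal i.+2.
have CD : lower_central G i.+2 `<=` D by move=> x Cx; apply: sub_generated; right.
have sD : is_subgroup D by exact: generated_subgroup.
have DC : D `<=` lower_central G i.+1.
  apply: generated_sub; first by case: (lower_central_normal i.+1).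
  move=> x [/s1_sub //|].
  exact: (commutator_normal_sub (lower_central_normal i.+1)).
have nD : is_normal_subgroup D.
  apply: (normal_between sD CD); exact: commutatorS.
apply: commutator_sub => // x g Cx _.
apply/(quot_pi1 nD); rewrite quot_piR; apply/eqP/commgP/commute_sym.
suff : lower_central G i `<=` [set x | commute (quot_pi nD g) (quot_pi nD x)].
  by apply.
apply: subset_trans s_gen _.
apply: generated_sub => [|a [sa|Ca]]; first exact: centralizer_mod_subgroup.
- suff : [set: G] `<=` [set h | commute (quot_pi nD a) (quot_pi nD h)].
    by move=> /(_ g I) /commute_sym.
  rewrite -s0G; apply: generated_sub => [|b sb]; first exact: centralizer_mod_subgroup.
  apply/commgP/eqP; rewrite -quot_piR; apply/quot_pi1; rewrite /D.
  apply: sub_generated; left; by apply: allpairs_f.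
- apply/commute_sym/commgP/eqP; rewrite -quot_piR; apply/quot_pi1; apply: CD.
  exact: (@mem_commutator _ (lower_central G i.+1)).
Qed.

(** Every subgroup is finitely generated, by composing along the lower central series. This supplies
    the finite rank used in the strongly simple case. *)
Lemma nilpotent_noetherian n S : finitely_generated G ->
  lower_central G n = [set 1] -> is_subgroup S ->
  exists s, generated [set` s] = S.
Proof.
move=> G_fg Gn sS.
have noeth i : noetherian_mod (lower_central G i) [set: G].
  elim: i => [|i IHi]; first exact: noetherian_mod_refl.
  apply: noetherian_mod_trans IHi.
  have [s [s_sub s_gen]] := lower_central_fg i G_fg.
  have N := lower_central_normal i.+1.
  have := @noetherian_mod_central _ s N.
  move=> h S' /h [x g xs|t [tS tP]]; first by apply: mem_commutator => //; exact: s_sub.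
  by exists t; split=> // x Sx /s_gen; exact: tP.
have [s [sS' sP]] := noeth n _ sS; exists s; apply/seteqP; split.
  exact: generated_sub.
move=> x Sx; have [//|y sy] := sP x Sx.
by rewrite Gn => /mulg1_eq; rewrite invgK => <-.
Qed.

End Noetherian.

(** * Simple virtual endomorphisms *)

Lemma commg_mul_central (G : groupType) (x y z t : G) :
  (forall g, commute z g) -> (forall g, commute t g) ->
  [~ x * z, y * t] = [~ x, y].
Proof.
move=> cz ct; rewrite commgM.
have /commgP/eqP -> : commute (x * z) t by exact/commute_sym.
rewrite mul1g conjgE -ct mulKg commMg.
have /commgP/eqP -> : commute z y by exact: cz.
by rewrite mulg1 conjgE -cz mulKg.
Qed.

Section QuasiInvariant.
Variables (G : groupType) (n : nat) (H : set G) (f : G -> G).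
Hypotheses (G_nil : lower_central G n = [set 1]) (sH : is_subgroup H).
Hypotheses (GH : forall g, isolator H g) (f_hom : is_hom_on H f).

Local Notation T := (isolated_series G).

(* For normal T_j this says that B / T_j is invariant under the partial
   endomorphism of G / T_j induced by f. *)
Definition quasi_invariant j (B : set G) : Prop :=
  [/\ is_subgroup B, T j `<=` B, B `<=` setM H (T j) &
      forall x, B x -> H x -> B (f x)].

Let nT j : is_normal_subgroup (T j) := isolated_series_normal G_nil j.
Let sT j : is_subgroup (T j) := (nT j).1.

Lemma quasi_invariant_decomp j B x : quasi_invariant j B -> B x ->
  exists y t, [/\ B y, H y, T j t & x = y * t].
Proof.
move=> [sB TB BHT _] Bx; have [h [t [Hh Tt e]]] := BHT _ Bx.
exists h, t; split=> //; apply: subgroupMr sB (TB _ Tt) _.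
by rewrite -e.
Qed.

Lemma quasi_invariant_commutator j B : quasi_invariant j B ->
  commutator_subgroup B B `<=`
    setM (commutator_subgroup (B `&` H) (B `&` H)) (T j.+1).
Proof.
move=> qB; apply: commutator_sub.
  by apply: setM_subgroup => //; exact: commutator_subgroup_subgroup.
move=> x y Bx By.
have [x' [z [Bx' Hx' Tz ->]]] := quasi_invariant_decomp qB Bx.
have [y' [t [By' Hy' Tt ->]]] := quasi_invariant_decomp qB By.
have cT u g : T j u -> commute (quot_pi (nT j.+1) u) g.
  move=> Tu; rewrite -(quot_pi_val g); apply: commute_mod Tu.
  exact: isolated_series_comm.
exists [~ x', y'], ([~ x', y']^-1 * [~ x' * z, y' * t]); split.
- exact: mem_commutator.
- apply/(quot_pi_eq (nT j.+1)).
  rewrite !quot_piR !quot_piM commg_mul_central //.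
    by move=> g; exact: cT.
  by move=> g; exact: cT.
- by rewrite mulVKg.
Qed.

Lemma quasi_invariant_derived j B : quasi_invariant j B ->
  quasi_invariant j.+1 (setM (commutator_subgroup B B) (T j.+1)).
Proof.
move=> qB; have [sB TB BHT fB] := qB.
have sBB := commutator_subgroup_subgroup B B.
have sL : commutator_subgroup (B `&` H) (B `&` H) `<=` H.
  by apply: commutator_sub => // x y [_ Hx] [_ Hy]; exact: subgroupR.
have sHT : is_subgroup (setM H (T j.+1)) by exact: setM_subgroup.
have sN : setM (commutator_subgroup B B) (T j.+1) `<=`
    setM (commutator_subgroup (B `&` H) (B `&` H)) (T j.+1).
  apply: setM_sub.
  - by apply: setM_subgroup => //; exact: commutator_subgroup_subgroup.
  - exact: quasi_invariant_commutator.
  - by apply: setM_subr; exact: commutator_subgroup_subgroup.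
split.
- exact: setM_subgroup.
- exact: setM_subr.
- by apply: subset_trans sN _; exact: setMS.
- move=> x /sN [v [t [Lv Tt ->]]] Hx.
  (* In x = v t both x and v lie in H, hence so does t, and f can be applied to each factor. *)
  have Hv := sL _ Lv; have Ht := subgroupMl sH Hv Hx.
  exists (f v), (f t); rewrite f_hom //; split=> //.
    have [] := @hom_on_commutator _ _ _ sH f_hom (B `&` H) (B `&` H) B B
      _ _ _ _ _ Lv => //.
    + by move=> y [By Hy]; exact: fB.
    + by move=> y [By Hy]; exact: fB.
  exact: (isolated_series_hom G_nil sH GH f_hom Tt Ht).
Qed.

Lemma quasi_invariant_same j B : T j `<=` setM H (T j.+1) ->
  quasi_invariant j B -> quasi_invariant j.+1 B.
Proof.
move=> TH [sB TB BHT fB]; split=> //.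
  by apply: subset_trans TB; exact: isolated_series_sub G_nil _.
apply: subset_trans BHT _; apply: setM_sub => //; first exact: setM_subgroup.
exact: setM_subl.
Qed.

Lemma quasi_invariant_f_invariant j B : T j = [set 1] ->
  quasi_invariant j B -> f_invariant H f B.
Proof.
move=> T1 [sB TB BHT fB].
have BH : B `<=` H by move=> x /BHT [h [t []]]; rewrite T1 => Hh -> ->; rewrite mulg1.
by split=> // _ [x Bx <-]; apply: fB => //; exact: BH.
Qed.

(** * Counting strict steps by the prime divisors of the indices *)

Variables (m : nat) (c : G -> 'I_m).
Hypotheses (c_surj : forall i, exists x, c x = i).
Hypothesis cP : forall x y, c x = c y <-> H (x / y).
Hypothesis m_gt0 : (0 < m)%N.

(** The quantity spent in both bounds: it starts at l(m), stays constant while H T_j = H T_(j+1),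
    and drops at each strict step. *)
Let lam j := num_prime_divisors (rel_index c (setM H (T j))).

Lemma lam0 : lam 0 = num_prime_divisors m.
Proof.
rewrite /lam (_ : setM _ _ = [set: G]) ?rel_indexT //.
by apply/seteqP; split=> // x _; exact: setM_subr.
Qed.

Lemma lam_ltn j : ~ (T j `<=` setM H (T j.+1)) -> (lam j.+1 < lam j)%N.
Proof.
move=> nTH; have sHT i : is_subgroup (setM H (T i)) by exact: setM_subgroup.
have HHT i : H `<=` setM H (T i) by exact: setM_subl.
have sS : setM H (T j.+1) `<=` setM H (T j).
  by apply: setMS => //; exact: isolated_series_sub G_nil _.
apply: ltn_num_prime_divisors.
- have := rel_indexS sH c_surj cP (sHT j) (@setT_subgroup G) (HHT j) (@subsetT _ _).
  by rewrite (rel_indexT c_surj) => /dvdn_gt0; apply.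
- by apply: (rel_indexS sH c_surj cP (sHT _) (sHT _) (HHT _)).
- apply/eqP => e; apply: nTH; apply: subset_trans (@setM_subr _ _ _ sH) _.
  exact: (rel_index_eq cP (sHT _) (sHT _) (HHT _) sS e).
Qed.

(** Here s counts the derivations made so far; each is paid for by a drop of [lam], so s + [lam j]
    never grows. *)
Lemma derived_series_quasi_invariant j : exists K s,
  [/\ is_normal_subgroup K, quasi_invariant j K, derived_series G s `<=` K &
      (s + lam j <= num_prime_divisors m)%N].
Proof.
elim: j => [|j [K [s [nK qK sK le]]]].
  exists [set: G], 0%N; rewrite lam0; split=> //; split=> //.
  by move=> x _; exact: setM_subr.
have [TH|nTH] := pselect (T j `<=` setM H (T j.+1)).
  exists K, s; split=> //; first exact: quasi_invariant_same.
  rewrite (leq_trans _ le) // leq_add2l /lam (_ : setM H (T j) = setM H (T j.+1)) //.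
  apply/seteqP; split.
  - apply: setM_sub => //; first exact: setM_subgroup.
    exact: setM_subl.
  - by apply: setMS => //; exact: isolated_series_sub G_nil _.
exists (setM (commutator_subgroup K K) (T j.+1)), s.+1; split.
- by apply: setM_normal => //; exact: commutator_normal.
- exact: quasi_invariant_derived.
- apply: subset_trans (@setM_subl _ _ _ (sT j.+1)) => /=.
  exact: commutatorS.
- by rewrite (leq_trans _ le) // addSnnS leq_add2l; exact: lam_ltn.
Qed.

Hypothesis T1 : T n = [set 1].

Lemma derived_length_leq : simple_hom H f ->
  (derived_length G <= num_prime_divisors m)%N.
Proof.
move=> f_simple; have [K [s [nK qK sK le]]] := derived_series_quasi_invariant n.
have K1 : K = [set 1].
  by apply: f_simple => //; exact: quasi_invariant_f_invariant qK.
have [_] : derived_series G (derived_length G) = [set 1] /\ (derived_length G <= s)%N.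
  apply: leastP; apply/seteqP; split; first by rewrite -K1.
  move=> _ ->; case: s {sK le} => //= s.
  by case: (commutator_subgroup_subgroup (derived_series G s) (derived_series G s)).
by move=> les; rewrite (leq_trans les) // (leq_trans _ le) // leq_addr.
Qed.

Hypothesis T_strict :
  forall j, T j `<=` setM H (T j.+1) -> T j `<=` T j.+1.

(** Under [T_strict], a step at which [lam] need not drop is a repetition T_j = T_(j+1), which can
    only occur at the trivial group. *)
Lemma isolated_series_strict j : T j = [set 1] \/
  (j + lam j <= num_prime_divisors m)%N.
Proof.
elim: j => [|j [Tj1|le]]; first by right; rewrite add0n lam0.
  left; apply/seteqP; split; last by move=> _ ->; case: (sT j.+1).
  by rewrite -Tj1; exact: isolated_series_sub G_nil _.
have [/T_strict TT|nTH] := pselect (T j `<=` setM H (T j.+1)); last first.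
  by right; rewrite (leq_trans _ le) // addSnnS leq_add2l; exact: lam_ltn.
have Te : T j.+1 = T j.
  by apply/seteqP; split=> //; exact: isolated_series_sub G_nil _.
(* Each term determines the next, so a repetition makes the series constant from there on, and it
   must agree with T_n = 1. *)
have Tk k : T (j + k) = T j.
  by elim: k => [|k IHk]; rewrite ?addn0 // addnS /= IHk -[RHS]Te.
left; rewrite Te; apply/seteqP; split; last by move=> _ ->; case: (sT j).
rewrite -(Tk n) -T1; elim: j {TT Te Tk le} => // j IHj.
by rewrite addSn; apply: subset_trans IHj; exact: isolated_series_sub G_nil _.
Qed.

Lemma nilpotency_class_leq : (nilpotency_class G <= num_prime_divisors m)%N.
Proof.
set k := num_prime_divisors m.
have Tk1 : T k.+1 = [set 1].
  by have [//|] := isolated_series_strict k.+1; rewrite addSn ltnNge leq_addr.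
(* The count gives triviality only at k + 1. If T_k were nontrivial then [lam k] would be 0, leaving
   no room for a drop, so T_k would lie in T_(k+1) = 1. *)
have Tk : T k = [set 1].
  have [//|le] := isolated_series_strict k.
  have TH : T k `<=` setM H (T k.+1).
    apply: contrapT => /lam_ltn lt; move: le.
    by rewrite -[X in (_ <= X)%N]addn0 leq_add2l leqNgt (leq_ltn_trans _ lt).
  apply/seteqP; split; last by move=> _ ->; case: (sT k).
  by rewrite -Tk1; exact: T_strict.
have [_] : lower_central G (nilpotency_class G) = [set 1] /\
    (nilpotency_class G <= k)%N.
  apply: leastP; apply/seteqP; split.
    by rewrite -Tk; exact: lower_central_sub_isolated.
  move=> _ ->; rewrite lower_centralE.
  by case: (iter_comm_subgroup [set: G] k (@setT_subgroup G)).
by [].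
Qed.

End QuasiInvariant.

(** * Partial endomorphisms of abelian groups *)

Section AbelianGroups.
Local Open Scope ring_scope.

Definition add_subgroup (A : zmodType) (S : set A) : Prop :=
  S 0 /\ forall x y, S x -> S y -> S (x - y).

Section AddSubgroup.
Variables (A : zmodType) (S : set A).
Hypothesis sS : add_subgroup S.

Lemma add_subgroupN x : S x -> S (- x).
Proof. by case: sS => S0 SB Sx; rewrite -sub0r; exact: SB. Qed.

Lemma add_subgroupD x y : S x -> S y -> S (x + y).
Proof.
by case: sS => _ SB Sx Sy; rewrite -[y]opprK; apply: SB => //; exact: add_subgroupN.
Qed.

Lemma add_subgroupMn x n : S x -> S (x *+ n).
Proof.
by case: sS => S0 _ Sx; elim: n => // n IHn; rewrite mulrSr; exact: add_subgroupD.
Qed.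

Lemma add_subgroupMz x (n : int) : S x -> S (x *~ n).
Proof.
move=> Sx; case: n => n; first by rewrite -pmulrn; exact: add_subgroupMn.
by rewrite NegzE mulrNz -pmulrn; apply: add_subgroupN; exact: add_subgroupMn.
Qed.

Lemma add_subgroup_sum I (r : seq I) (P : pred I) (F : I -> A) :
  (forall i, S (F i)) -> S (\sum_(i <- r | P i) F i).
Proof.
move=> SF; elim/big_ind: _ => // [|x y]; [by case: sS|exact: add_subgroupD].
Qed.

Lemma add_subgroup_trans x y z : S (x - y) -> S (y - z) -> S (x - z).
Proof. by move=> Sxy /(add_subgroupD Sxy); rewrite addrA subrK. Qed.

End AddSubgroup.

(** In the Smith form C = L D R with more rows than columns, the last row of D is zero; the witness
    is the last row of the inverse of L. *)
Lemma int_dependent k r (C : 'M[int]_(k, r)) : (r < k)%N ->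
  exists2 v : 'rV_k, v != 0 & v *m C = 0.
Proof.
case: k C => // k C rk; have [L Lu [R _ [d _ ->]]] := int_Smith_normal_form C.
exists (delta_mx 0 ord_max *m invmx L).
  apply/eqP => /(congr1 (mulmxr L)); rewrite /= mulmxKV // mul0mx => /matrixP.
  by move=> /(_ 0 ord_max); rewrite !mxE !eqxx.
rewrite !mulmxA mulmxKV //; apply/matrixP => i j; rewrite [RHS]mxE mxE big1 // => h _.
rewrite -rowE !mxE (_ : _ == _ = false) ?mulr0n ?mul0r //.
by apply/negbTE; rewrite gtn_eqF //=; exact: leq_trans (ltn_ord h) rk.
Qed.

(** * Independent families in finitely generated abelian groups *)

Section Rank.
Variables (A : zmodType) (r : nat) (b : 'I_r -> A).
Hypothesis A_gen : forall a, exists k : 'I_r -> int, a = \sum_i b i *~ k i.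

Definition independent k (s : 'I_k -> A) : Prop :=
  forall v : 'I_k -> int, \sum_i s i *~ v i = 0 -> forall i, v i = 0.

Lemma independent_leq k (s : 'I_k -> A) : independent s -> (k <= r)%N.
Proof.
move=> s_ind; rewrite leqNgt; apply/negP => rk.
have [C CE] := choice (fun i => A_gen (s i)).
have [v v0 vC] := int_dependent (\matrix_(i, j) C i j) rk.
case/eqP: v0; apply/rowP => i; rewrite mxE; move: i; apply: s_ind.
under eq_bigr => i _ do rewrite CE mulrz_suml.
rewrite exchange_big big1 // => j _ /=.
under eq_bigr => i _ do rewrite -mulrzA mulrC.
rewrite -mulrz_sumr (_ : \sum_i _ = 0) ?mulr0z //.
move/matrixP/(_ 0 j): vC; rewrite !mxE => e; apply: etrans e.
by apply: eq_bigr => i _; rewrite mxE.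
Qed.

(** Take x outside Z. If psi were injective, prepending x to the image under psi of an independent
    family would keep it independent: a multiple of x in the isolated subgroup Z has coefficient 0.
    Families would outgrow the number r of generators. *)
Lemma kernel_nontrivial (Z : set A) (psi : {additive A -> A}) :
  add_subgroup Z -> (forall a n, (0 < n)%N -> Z (a *+ n) -> Z a) ->
  (forall a, Z (psi a)) -> (exists a, ~ Z a) ->
  exists2 w, w != 0 & psi w = 0.
Proof.
move=> sZ Z_iso psiZ [x Zx]; apply: contrapT => psi_inj.
have psi0 a : psi a = 0 -> a = 0.
  move=> pa; apply: contrapT => /eqP a0; by apply: psi_inj; exists a.
suff [s /independent_leq] : exists s : 'I_r.+1 -> A, independent s.
  by rewrite ltnn.
elim: r.+1 => [|k [s s_ind]].
  by exists (fun i : 'I_0 => 0) => v _ [].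
exists (fun i => if unlift ord0 i is Some j then psi (s j) else x) => v.
rewrite big_ord_recl unlift_none.
under eq_bigr => j _ do rewrite liftK -raddfMz.
rewrite -raddf_sum => /eqP; rewrite addr_eq0 => /eqP vx.
have v0 : v ord0 = 0.
  have Zv : Z (x *~ v ord0) by rewrite vx; exact: add_subgroupN.
  case E : (v ord0) Zv => [[//|n]|n] Zv; case: Zx.
  - by apply: (Z_iso _ n.+1) .
  - apply: (Z_iso _ n.+1) => //; rewrite -[_ *+ _]opprK; exact: add_subgroupN Zv.
move=> i; have [j ->|->//] := unliftP ord0 i.
apply: (s_ind (fun j => v (lift ord0 j))); apply: psi0.
by apply/eqP; rewrite -oppr_eq0 -vx v0 mulr0z.
Qed.

End Rank.

Lemma mulrnzAC (A : zmodType) (a : A) (n : nat) (k : int) :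
  a *+ n *~ k = a *~ k *+ n.
Proof. by rewrite !pmulrn -!mulrzA mulrC. Qed.

Section IntegerCombinations.
Variables (A : zmodType) (n : nat) (l : 'I_n -> A).

Definition int_comb (v : 'rV[int]_n) : A := \sum_i l i *~ v 0 i.

Lemma int_comb_is_additive : zmod_morphism int_comb.
Proof.
move=> u v; rewrite /int_comb -sumrB; apply: eq_bigr => i _.
by rewrite !mxE mulrzBr.
Qed.

HB.instance Definition _ := GRing.isZmodMorphism.Build 'rV[int]_n A int_comb
  int_comb_is_additive.

Lemma int_combM (v : 'rV[int]_n) (M : 'M[int]_n) :
  int_comb (v *m M) = \sum_i int_comb (row i M) *~ v 0 i.
Proof.
rewrite /int_comb; under [RHS]eq_bigr => i _ do rewrite mulrz_suml.
rewrite exchange_big; apply: eq_bigr => j _ /=; rewrite mxE mulrz_sumr.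
by apply: eq_bigr => i _; rewrite -mulrzA mxE mulrC.
Qed.

Lemma int_combZ (v : 'rV[int]_n) (k : int) :
  int_comb (k *: v) = int_comb v *~ k.
Proof.
rewrite /int_comb mulrz_suml; apply: eq_bigr => i _.
by rewrite mxE -mulrzA mulrC.
Qed.

End IntegerCombinations.

(** * Invariant subgroups of a partial endomorphism of a torsion-free abelian group *)

Section PartialEndomorphism.
(** In the application A is B / T_(j+1), L the image of the intersection of B and H, Z the image of
    T_j, and phi is induced by f. *)
Variables (A : zmodType) (r : nat) (b : 'I_r.+1 -> A) (L Z : set A).
Variables (phi : A -> A) (N : nat).
Hypothesis A_gen : forall a, exists k : 'I_r.+1 -> int, a = \sum_i b i *~ k i.
Hypothesis A_tf : forall (a : A) n, (0 < n)%N -> a *+ n = 0 -> a = 0.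
Hypotheses (sL : add_subgroup L) (sZ : add_subgroup Z).
Hypotheses (N_gt0 : (0 < N)%N) (LN : forall a, L (a *+ N)).
Hypothesis phiD : forall x y, L x -> L y -> phi (x + y) = phi x + phi y.
Hypothesis Z_iso : forall a n, (0 < n)%N -> Z (a *+ n) -> Z a.
Hypothesis phiZ : forall x, Z x -> L x -> Z (phi x).
Hypothesis A_LZ : forall a, exists l, L l /\ Z (a - l).
Hypothesis Z_proper : exists a, ~ Z a.

Local Notation n := r.+1.

Lemma partial_end0 : phi 0 = 0.
Proof.
by case: sL => L0 _; apply: (@addrI _ (phi 0)); rewrite -phiD // !addr0.
Qed.

Lemma partial_endMz x (k : int) : L x -> phi (x *~ k) = phi x *~ k.
Proof.
move=> Lx.
have Mn m : phi (x *+ m) = phi x *+ m.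
  elim: m => [|m IHm]; first exact: partial_end0.
  by rewrite !mulrSr phiD ?IHm //; exact: add_subgroupMn.
case: k => m; first by rewrite -!pmulrn.
rewrite NegzE !mulrNz -!pmulrn -Mn; apply/eqP; rewrite -addr_eq0 -phiD.
- by rewrite addNr partial_end0.
- by apply: add_subgroupN => //; exact: add_subgroupMn.
- exact: add_subgroupMn.
Qed.

(** Multiplying by N first lands in L, which turns phi into an endomorphism of all of A, equal to N
    phi on L. *)
Definition scaled_end (a : A) : A := phi (a *+ N).
Local Notation Phi := scaled_end.

Lemma scaled_end_is_additive : zmod_morphism Phi.
Proof.
move=> x y; rewrite /Phi mulrnBl phiD //; last exact: add_subgroupN.
by rewrite -[- (y *+ N)]mulrN1z partial_endMz // mulrN1z.
Qed.

HB.instance Definition _ := GRing.isZmodMorphism.Build A A Phi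
  scaled_end_is_additive.

Lemma scaled_endE x : L x -> Phi x = phi x *+ N.
Proof. by move=> Lx; rewrite /Phi pmulrn partial_endMz // -pmulrn. Qed.

Lemma iter_scaled_end_is_additive k : zmod_morphism (iter k Phi).
Proof. by elim: k => // k IHk x y; rewrite /= IHk raddfB. Qed.

HB.instance Definition _ k := GRing.isZmodMorphism.Build A A (iter k Phi)
  (iter_scaled_end_is_additive k).

Lemma scaled_endZ x : Z x -> Z (Phi x).
Proof. by move=> Zx; apply: phiZ => //; exact: add_subgroupMn. Qed.

Lemma iter_scaled_endZ k x : Z x -> Z (iter k Phi x).
Proof. by move=> Zx; elim: k => //= k; exact: scaled_endZ. Qed.

(* The generators can be moved into L modulo Z, where phi acts by an integer
   matrix; its characteristic polynomial g is monic, and g(phi) maps A into Z. *)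
Lemma integral_mod : exists g : {poly int}, [/\ g \is monic, size g = n.+1 &
  forall a, Z (\sum_(k < n.+1) iter k Phi a *~ (g`_k * (N ^ (n - k))%N%:Z))].
Proof.
have [l lP] := choice (fun i => A_LZ (b i)).
have Ll i : L (l i) by case: (lP i).
have Zbl i : Z (b i - l i) by case: (lP i).
have A_comb a : exists v, Z (a - int_comb l v).
  have [k ->] := A_gen a; exists (\row_i k i); rewrite /int_comb -sumrB.
  apply: add_subgroup_sum => // i; rewrite mxE -mulrzBl.
  exact: add_subgroupMz.
have [m mP] := choice (fun i => A_comb (phi (l i))).
pose M : 'M[int]_n := \matrix_i m i.
have Phi_comb v : Z (Phi (int_comb l v) - int_comb l (v *m M) *+ N).
  rewrite int_combM -sumrMnl {1}/int_comb raddf_sum -sumrB.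
  apply: add_subgroup_sum => // i; rewrite raddfMz /= (scaled_endE (Ll i)).
rewrite rowK mulrnzAC -mulrnBl -mulrzBl.
  by apply: add_subgroupMn => //; apply: add_subgroupMz.
(* Modulo Z, Phi acts on combinations of the l i as N times the matrix M. *)
have iter_comb k v :
    Z (iter k Phi (int_comb l v) - int_comb l (v *m M ^+ k) *+ (N ^ k)).
  elim: k => [|k IHk]; first by rewrite mulmx1 subrr; case: sZ.
  apply: (add_subgroup_trans sZ) (_ : Z (_ - Phi (int_comb l (v *m M ^+ k) *+ N ^ k))) _.
    by rewrite /= -raddfB; exact: scaled_endZ.
  rewrite raddfMn expnS mulrnA -mulrnBl exprSr mulmxA.
  exact: add_subgroupMn.
exists (char_poly M); split; [exact: char_poly_monic|exact: size_char_poly|].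
move=> a; have [v Zav] := A_comb a.
set g := char_poly M.
have gM : \sum_(k < n.+1) g`_k *: (v *m M ^+ k) = 0.
  have := Cayley_Hamilton M; rewrite -/g.
  have {1}-> : g = \sum_(k < n.+1) g`_k *: 'X^k.
    by rewrite -poly_def -[in RHS](size_char_poly M) coefK.
  rewrite linear_sum => /(congr1 (mulmx v)); rewrite mulmx0 mulmx_sumr => e.
  apply: etrans e; apply: eq_bigr => k _.
  by rewrite linearZ /= rmorphXn /= horner_mx_X scalemxAr.
(* The weights N^(n-k) complete the factor N^k of Phi^k to N^n, so the subtracted terms add up to a
   multiple of g(M), which is zero by Cayley-Hamilton. *)
have -> : \sum_(k < n.+1) iter k Phi a *~ (g`_k * (N ^ (n - k))%N%:Z) =
   \sum_(k < n.+1) (iter k Phi a - int_comb l (v *m M ^+ k) *+ (N ^ k)) *~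
      (g`_k * (N ^ (n - k))%N%:Z).
  under [RHS]eq_bigr => k _ do rewrite mulrzBl.
  rewrite sumrB [X in _ - X](_ : _ = 0) ?subr0 //.
  under eq_bigr => k _.
    rewrite mulrzA mulrnzAC -pmulrn -mulrnA -expnD subnKC -1?ltnS //.
    rewrite -int_combZ; over.
  by rewrite sumrMnl -raddf_sum gM raddf0 mul0rn.
apply: add_subgroup_sum => // k; apply: add_subgroupMz => //.
apply: (add_subgroup_trans sZ) (iter_comb k v).
by rewrite -raddfB; exact: iter_scaled_endZ.
Qed.

(** The map psi is formally N^n g(phi) and sends A into Z, so it kills some nonzero w. As g is monic
    of degree n, the elements N^n phi^k(w) with k < n span an invariant subgroup. *)
Lemma invariant_subgroup_exists : exists W : set A,
  [/\ add_subgroup W, W `<=` L, forall x, W x -> W (phi x) &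
      exists2 w, W w & w != 0].
Proof.
have [g [g_monic size_g gZ]] := integral_mod.
pose psi a := \sum_(k < n.+1) iter k Phi a *~ (g`_k * (N ^ (n - k))%N%:Z).
have psiB : zmod_morphism psi.
  move=> x y; rewrite /psi -sumrB; apply: eq_bigr => k _.
  by rewrite raddfB mulrzBl.
pose psi_additive : {additive A -> A} :=
  HB.pack psi (GRing.isZmodMorphism.Build A A psi psiB).
have [w w0 psi_w] : exists2 w, w != 0 & psi w = 0.
  exact: (kernel_nontrivial A_gen (psi := psi_additive) sZ).
(* Formally u k is N^n phi^k(w). For k < n a factor N remains, which places u k in L and lets phi
   send it to u (k + 1). *)
pose u k := iter k Phi w *+ (N ^ (n - k)).
have phi_u k : (k < n)%N -> L (u k) /\ phi (u k) = u k.+1.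
  move=> kn; rewrite /u -subnSK // expnSr mulrnA; split=> //.
  by rewrite -/(Phi _) raddfMn.
have u_last : u n = - \sum_(k < n) u k *~ g`_k.
  apply/eqP; rewrite -addr_eq0 addrC; apply/eqP; apply: etrans psi_w.
  rewrite /psi [RHS]big_ord_recr /=.
  congr (_ + _).
    by apply: eq_bigr => k _; rewrite mulrzA /u pmulrn -!mulrzA mulrC.
  move: g_monic; rewrite monicE lead_coefE size_g /= => /eqP ->.
  by rewrite mul1r -pmulrn.
exists [set x | exists v : 'I_n -> int, x = \sum_(k < n) u k *~ v k]; split.
- split; first by exists (fun=> 0); rewrite big1 // => k _; rewrite mulr0z.
  move=> _ _ [v ->] [v' ->]; exists (fun k => v k - v' k).
  by rewrite -sumrB; apply: eq_bigr => k _; rewrite mulrzBr.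
- move=> _ [v ->]; apply: add_subgroup_sum => // k; apply: add_subgroupMz => //.
  by case: (phi_u _ (ltn_ord k)).
- move=> _ [v ->].
  have -> : phi (\sum_(k < n) u k *~ v k) = \sum_(k < n) u k.+1 *~ v k.
    pose P x y := L x /\ phi x = y.
    suff [] : P (\sum_(k < n) u k *~ v k) (\sum_(k < n) u k.+1 *~ v k) by [].
    apply: (big_ind2 P) => [|x x' y y' [Lx ex] [Ly ey]|k _].
    + by split; [case: sL|exact: partial_end0].
    + by split; [exact: add_subgroupD|rewrite phiD // ex ey].
    + have [Lu eu] := phi_u _ (ltn_ord k).
      by split; [exact: add_subgroupMz|rewrite partial_endMz // eu].
  rewrite big_ord_recr /= u_last.
  (* Companion matrix action: coefficients shift up by one, and the top one is fed back through
     [u_last]. *)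
  exists (fun k => (if unlift ord0 k is Some j then v (widen_ord (leqnSn r) j) else 0)
    - g`_k * v ord_max).
  under [RHS]eq_bigr => k _ do rewrite mulrzBr mulrzA.
  rewrite sumrB mulNrz mulrz_suml; congr (_ - _).
  rewrite big_ord_recl unlift_none mulr0z add0r.
  by apply: eq_bigr => k _; rewrite liftK.
(* The element u 0 = N^n w is nonzero because A is torsion-free. *)
- exists (u 0%N).
    exists (fun k => (k == ord0)%:Z); rewrite big_ord_recl eqxx mulr1z big1 ?addr0 //.
  apply/eqP => /A_tf w_eq0; case/eqP: w0; apply: w_eq0.
  by rewrite expn_gt0 N_gt0.
Qed.

End PartialEndomorphism.

End AbelianGroups.

(** * Strongly simple virtual endomorphisms *)

Section AbelianSubgroup.
Variables (G : groupType) (S : set G).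
Hypotheses (sS : is_subgroup S) (cS : forall x y, S x -> S y -> commute x y).

Definition abelian_subgroup of is_subgroup S &
  (forall x y, S x -> S y -> commute x y) := {x : G | `[< S x >]}.

Local Notation A := (abelian_subgroup sS cS).

HB.instance Definition _ := Choice.on A.

Lemma abelian_mem (a : A) : S (val a).
Proof. exact/asboolP/(valP a). Qed.

Definition abelian_in x (Sx : S x) : A := exist _ x (introT (asboolP _) Sx).

Definition abelian_zero : A := abelian_in (let: And3 S1 _ _ := sS in S1).
Definition abelian_add (a b : A) : A :=
  abelian_in (let: And3 _ SM _ := sS in SM _ _ (abelian_mem a) (abelian_mem b)).
Definition abelian_opp (a : A) : A :=
  abelian_in (let: And3 _ _ SV := sS in SV _ (abelian_mem a)).

Lemma abelian_addA : associative abelian_add.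
Proof. by move=> a b c; apply: val_inj; rewrite /= mulgA. Qed.

Lemma abelian_addC : commutative abelian_add.
Proof. by move=> a b; apply: val_inj; apply: cS; exact: abelian_mem. Qed.

Lemma abelian_add0 : left_id abelian_zero abelian_add.
Proof. by move=> a; apply: val_inj; rewrite /= mul1g. Qed.

Lemma abelian_addN : left_inverse abelian_zero abelian_opp abelian_add.
Proof. by move=> a; apply: val_inj; rewrite /= mulVg. Qed.

HB.instance Definition _ := GRing.isZmodule.Build A
  abelian_addA abelian_addC abelian_add0 abelian_addN.

End AbelianSubgroup.

(** The image of B in G / N, written additively. The class map is total on G for convenience and is
    controlled only on B, which need not contain N. *)
Lemma abelian_section (G : groupType) (B N : set G) :
  is_subgroup B -> is_normal_subgroup N -> commutator_subgroup B B `<=` N ->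
  exists (A : zmodType) (cl : G -> A),
    [/\ forall x y, B x -> B y -> cl (x * y) = (cl x + cl y)%R,
        forall a, exists x, B x /\ cl x = a &
        forall x, B x -> cl x = 0%R <-> N x].
Proof.
move=> sB nN BN; have [B1 BM BV] := sB.
pose S : set (quotient nN) := quot_pi nN @` B.
have sS : is_subgroup S.
  split.
  - by exists 1 => //; apply/quot_pi1; have [[]] := nN.
  - by move=> _ _ [x Bx <-] [y By <-]; exists (x * y); [exact: BM|rewrite quot_piM].
  - by move=> _ [x Bx <-]; exists x^-1; [exact: BV|rewrite quot_piV].
have cS u v : S u -> S v -> commute u v.
  move=> [x Bx <-] [y By <-]; apply/commgP/eqP; rewrite -quot_piR.
  by apply/quot_pi1/BN; exact: mem_commutator.
pose A : zmodType := abelian_subgroup sS cS.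
pose cl x : A := insubd (0%R : A) (quot_pi nN x).
have val_cl x : B x -> val (cl x) = quot_pi nN x.
  by move=> Bx; rewrite insubdK //; apply/asboolP; exists x.
exists A, cl; split.
- move=> x y Bx By; apply: val_inj; rewrite val_cl; last exact: BM.
  by rewrite quot_piM -!val_cl.
- move=> a; have [x Bx xa] := abelian_mem a.
  by exists x; split=> //; apply: val_inj; rewrite val_cl.
- move=> x Bx; rewrite -(quot_pi1 nN) -val_cl //.
  by split=> [->|e] //; apply: val_inj.
Qed.

Section StronglySimple.
Variables (G : groupType) (n : nat) (H : set G) (f : G -> G) (e : nat).
Hypotheses (G_nil : lower_central G n = [set 1]) (sH : is_subgroup H).
Hypotheses (G_fg : finitely_generated G) (f_hom : is_hom_on H f).
Hypotheses (e_gt0 : (0 < e)%N) (He : forall g, H (g ^+ e)).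

Local Notation T := (isolated_series G).

Let nT j : is_normal_subgroup (T j) := isolated_series_normal G_nil j.
Let sT j : is_subgroup (T j) := (nT j).1.

Let GH g : isolator H g.
Proof. by exists e. Qed.

Lemma quasi_invariant_abelian j B : quasi_invariant H f j B ->
  commutator_subgroup B B `<=` T j.+1 -> ~ (B `<=` T j) ->
  exists B', quasi_invariant H f j.+1 B' /\ ~ (B' `<=` T j.+1).
Proof.
move=> qB BB BT; have [sB TB BHT fB] := qB; have [B1 BM BV] := sB.
have TT : T j.+1 `<=` T j by exact: isolated_series_sub G_nil _.
have NB : T j.+1 `<=` B by exact: subset_trans TB.
have fT i x : T i x -> H x -> T i (f x).
  by move=> Tx Hx; exact: (isolated_series_hom G_nil sH GH f_hom Tx Hx).
have T_iso i x k : (0 < k)%N -> T i (x ^+ k) -> T i x.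
  by move=> k0 Tx; apply: isolated_seriesK; exists k.
have [H1 HM HV] := sH.
have [A [cl [clM cl_surj cl0]]] := abelian_section sB (nT j.+1) BB.
have cl1 : cl 1 = 0%R by apply/cl0 => //; have [] := sT j.+1.
have clV x : B x -> cl x^-1 = (- cl x)%R.
  move=> Bx; apply/eqP; rewrite -addr_eq0 -clM ?mulVg ?cl1 //; exact: BV.
have clX x k : B x -> cl (x ^+ k) = (cl x *+ k)%R.
  move=> Bx; elim: k => [|k IHk]; first by rewrite cl1.
  by rewrite expgS mulrS clM ?IHk //; exact: subgroupX.
have cl_eq x y : B x -> B y -> cl x = cl y <-> T j.+1 (x^-1 * y).
  move=> Bx By; rewrite -cl0; last by apply: BM => //; exact: BV.
  rewrite clM ?clV //; last exact: BV.
  rewrite addrC; split=> [->|/eqP]; first by rewrite subrr.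
  by rewrite subr_eq0 => /eqP.
have cl_T x z : B x -> T j z -> cl x = cl z -> T j x.
  move=> Bx Tz /cl_eq -/(_ Bx (TB _ Tz)) /TT Txz.
  have [T1 TM TV] := sT j.
  by rewrite -[x]invgK -[x^-1](mulgK z); apply: (TV); apply: (TM) => //; exact: TV.
pose L : set A := [set a | exists x, [/\ B x, H x & cl x = a]].
pose Z : set A := [set a | exists x, T j x /\ cl x = a].
(* The map induced by f, computed on a chosen representative in B and H. The choice is immaterial
   because f maps elements of T_(j+1) lying in H into T_(j+1). *)
pose phi a := cl (f (xget 1 [set x | [/\ B x, H x & cl x = a]])).
have phiE x : B x -> H x -> phi (cl x) = cl (f x).
  move=> Bx Hx; rewrite /phi; case: xgetP => [y _ [By Hy yx]|/(_ x)[]//].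
  apply/cl_eq; [exact: fB|exact: fB|].
  rewrite -(hom_onV sH) // -f_hom //; last exact: HV.
  apply: fT; last by apply: HM => //; exact: HV.
  exact/cl_eq.
have [s sE] := nilpotent_noetherian G_fg G_nil sB.
have Bs i : B (nth 1 s i).
  have [i_s|s_i] := ltnP i (size s); last by rewrite nth_default.
  by rewrite -sE; apply: sub_generated; exact: mem_nth.
(* The extra index yields the default 1, of class 0; it ensures a positive number of generators,
   hence a matrix ring. *)
pose b (i : 'I_(size s).+1) := cl (nth 1 s i).
have A_gen a : exists k : 'I_(size s).+1 -> int, a = (\sum_i b i *~ k i)%R.
  have [x [Bx <-]] := cl_surj a.
  suff : B `<=` [set x | B x /\
      exists k : 'I_(size s).+1 -> int, cl x = (\sum_i b i *~ k i)%R].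
    by move=> /(_ x Bx) [].
  rewrite -[X in X `<=` _]sE; apply: generated_sub => [|y ys].
  - split.
    + by split=> //; exists (fun=> 0%R); rewrite cl1 big1 // => i _; rewrite mulr0z.
    + move=> y z [By [k yE]] [Bz [k' zE]]; split; first exact: BM.
      exists (fun i => k i + k' i)%R; rewrite clM // yE zE -big_split /=.
      by apply: eq_bigr => i _; rewrite mulrzDr.
    + move=> y [By [k yE]]; split; first exact: BV.
      exists (fun i => - k i)%R; rewrite clV // yE -sumrN.
      by apply: eq_bigr => i _; rewrite mulrNz.
  - split; first by rewrite -sE; exact: sub_generated.
    have ys' : (index y s < (size s).+1)%N by rewrite ltnS index_size.
    exists (fun i => ((i == Ordinal ys')%:Z)%R); rewrite (bigD1 (Ordinal ys')) //=.
    rewrite eqxx mulr1z big1 ?addr0 /b ?nth_index // => i /negbTE ->.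
    by rewrite mulr0z.
have [||||||||||W [sW WL Wphi [w Ww w0]]] :=
    @invariant_subgroup_exists A (size s) b L Z phi e A_gen.
- move=> a k k0; have [x [Bx <-]] := cl_surj a; rewrite -clX // => /cl0 Tx.
  by apply/cl0 => //; apply: (T_iso _ _ _ k0); apply: Tx; exact: subgroupX.
- split; first by exists 1; split.
  move=> _ _ [x [Bx Hx <-]] [y [By Hy <-]]; exists (x * y^-1).
  by rewrite clM ?clV //; [split=> //; [apply: BM|apply: HM]; auto|exact: BV].
- split; first by exists 1; split=> //; have [] := sT j.
  move=> _ _ [x [Tx <-]] [y [Ty <-]]; have [_ TM TV] := sT j.
  exists (x * y^-1); rewrite clM ?clV //; try exact: TB.
    by split=> //; apply: (TM) => //; exact: TV.
  by apply: BV; exact: TB.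
- exact: e_gt0.
- move=> a; have [x [Bx <-]] := cl_surj a; exists (x ^+ e).
  by rewrite clX //; split=> //; exact: subgroupX.
- move=> _ _ [x [Bx Hx <-]] [y [By Hy <-]].
  rewrite -clM // !phiE //; [|exact: BM|exact: HM].
  by rewrite f_hom // clM //; exact: fB.
- move=> a k k0; have [x [Bx <-]] := cl_surj a; rewrite -clX // => -[z [Tz zx]].
  exists x; split=> //; apply: (T_iso _ _ _ k0); apply: cl_T Tz _ => //.
  exact: subgroupX.
- move=> _ [x [Tx <-]] [y [By Hy yx]]; have Ty := cl_T _ _ By Tx yx.
  by rewrite -yx phiE //; exists (f y); split=> //; exact: fT.
- move=> a; have [x [Bx <-]] := cl_surj a.
  have [y [t [By Hy Tt ->]]] := quasi_invariant_decomp qB Bx.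
  exists (cl y); split; first by exists y.
  exists t; split=> //; rewrite clM //; last exact: TB.
  by rewrite addrAC subrr add0r.
- apply: contrapT => /forallNP ZA; apply: BT => x Bx.
  have /contrapT [z [Tz zx]] := ZA (cl x); exact: cl_T Tz _.
have [W0 WB] := sW.
(* The preimage of W in B. Since W is inside L, its elements are congruent modulo T_(j+1) to
   elements of H, as quasi-invariance demands. *)
exists [set x | B x /\ W (cl x)]; split.
  split.
  - split=> [|x y [Bx Wx] [By Wy]|x [Bx Wx]].
    + by split=> //; rewrite cl1.
    + by split; [exact: BM|rewrite clM //; exact: add_subgroupD].
    + by split; [exact: BV|rewrite clV //; exact: add_subgroupN].
  - by move=> x Tx; have Bx := NB _ Tx; split=> //; rewrite (cl0 _ Bx).2.
  - move=> x [Bx /WL [y [By Hy /cl_eq yx]]]; exists y, (y^-1 * x).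
    by rewrite mulVKg; split=> //; exact: yx.
  - move=> x [Bx Wx] Hx; split; first exact: fB.
    by rewrite -phiE //; exact: Wphi.
have [x [Bx xw]] := cl_surj w; move=> WT; case/eqP: w0; rewrite -xw.
by apply/cl0 => //; apply: WT; split=> //=; rewrite xw.
Qed.

Lemma quasi_invariant_proper_step j B : quasi_invariant H f j B -> ~ (B `<=` T j) ->
  exists B', quasi_invariant H f j.+1 B' /\ ~ (B' `<=` T j.+1).
Proof.
move=> qB BT.
have [BB|BB] := pselect (commutator_subgroup B B `<=` T j.+1).
  exact: quasi_invariant_abelian qB BB BT.
exists (setM (commutator_subgroup B B) (T j.+1)); split.
  exact: (quasi_invariant_derived G_nil sH GH f_hom qB).
by move=> sBT; apply: BB; apply: subset_trans sBT; exact: setM_subl.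
Qed.

(** If T_j lies in H T_(j+1), then T_j itself is quasi-invariant at level j + 1. Were it not inside
    T_(j+1), propagating it n more levels, where the series is trivial, would yield a nontrivial
    f-invariant subgroup. *)
Lemma isolated_series_proper j : T n = [set 1] -> strongly_simple_hom H f ->
  T j `<=` setM H (T j.+1) -> T j `<=` T j.+1.
Proof.
move=> Tn f_simple TH; apply: contrapT => nT1.
have [B [qB BT]] : exists B, quasi_invariant H f (j.+1 + n) B /\
    ~ (B `<=` T (j.+1 + n)).
  elim: n => [|k [B [qB BT]]]; last first.
    by rewrite addnS; exact: quasi_invariant_proper_step qB BT.
  rewrite addn0; exists (T j); split=> //; split=> //.
    exact: isolated_series_sub G_nil _.
  by move=> x Tx Hx; exact: (isolated_series_hom G_nil sH GH f_hom Tx Hx).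
have T1 : T (j.+1 + n) = [set 1].
  apply/seteqP; split; last by move=> _ ->; have [] := sT (j.+1 + n).
  rewrite -Tn; elim: j.+1 => // i IHi.
  by rewrite addSn; apply: subset_trans IHi; exact: isolated_series_sub G_nil _.
apply: BT; rewrite T1 -(f_simple B) //.
exact: (quasi_invariant_f_invariant T1 qB).
Qed.

End StronglySimple.

Theorem theorem3 (G : groupType) (H : set G) (m : nat) (f : G -> G)
  (G_fg : finitely_generated G) (G_tf : torsion_free G)
  (G_nil : nilpotent_group G)
  (H_sub : is_subgroup H) (m_gt1 : (1 < m)%N) (H_index : has_index H m)
  (f_hom : is_hom_on H f) :
  (simple_hom H f -> (derived_length G <= num_prime_divisors m)%N) /\
  (strongly_simple_hom H f -> (nilpotency_class G <= num_prime_divisors m)%N).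
Proof.
have [n Gn] := G_nil; have [c [c_surj cP]] := coset_index_exists H_sub H_index.
have He g : H (g ^+ m`!) := finite_index_fact H_sub cP g.
have GH g : isolator H g by exists m`! => //; exact: fact_gt0.
have Tn := isolated_series_eq1 Gn G_tf.
have m0 := ltnW m_gt1.
split; first exact: (derived_length_leq Gn H_sub GH f_hom c_surj cP m0 Tn).
move=> f_simple; apply: (nilpotency_class_leq Gn H_sub c_surj cP m0 Tn) => j.
exact: (isolated_series_proper Gn H_sub G_fg f_hom (fact_gt0 m) He Tn f_simple).
Qed.
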